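(* Let $n\geq 1$ be an odd integer such that $2n+1$ is prime. Then there exists a cellular biembedding of $K_{(2n+1)\times n}$ into an orientable surface such that the length of every face is a multiple of $n(2n+1)$.
   Context: $K_{q\times r}$ denotes the complete multipartite graph with $q$ parts each of size $r$. An embedding of a graph $\Gamma$ (as a $1$-dimensional simplicial complex) in a surface $\Sigma$ is a continuous injective map $\phi:\Gamma\to\Sigma$; the connected components of $\Sigma\setminus\phi(\Gamma)$ are its faces; the embedding is cellular if every face is homeomorphic to an open disc. A circuit decomposition of a graph is a set of circuits (closed trails, without repeated edges but possibly with repeated vertices) whose edge-sets partition the edge-set. A biembedding of two circuit decompositions $\mathcal{D},\mathcal{D}'$ of a simple graph $\Gamma$ is a face $2$-colorable embedding of $\Gamma$ in which (the boundaries of the faces of) one color class are the circuits of $\mathcal{D}$ and those of the other color class are the circuits of $\mathcal{D}'$. A biembedding of $\Gamma$ means a biembedding of some two circuit decompositions of $\Gamma$. The length of a face is the number of edges of its boundary circuit. *)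

(* Defs.v *)
From HB Require Import structures.
From mathcomp Require Import all_boot all_order all_algebra.
From mathcomp Require Import all_classical all_reals all_analysis.

Set Implicit Arguments.
Unset Strict Implicit.
Unset Printing Implicit Defensive.

Import Order.TTheory GRing.Theory Num.Theory.
Import numFieldNormedType.Exports.

Local Open Scope classical_set_scope.
Local Open Scope ring_scope.

Definition open_disc (R : realType) : set (R * R) :=
  [set p | p.1 ^+ 2 + p.2 ^+ 2 < 1].

Definition closed_disc (R : realType) : set (R * R) :=
  [set p | p.1 ^+ 2 + p.2 ^+ 2 <= 1].

Definition homeomorphic (S T : topologicalType) (A : set S) (B : set T) : Prop :=
  exists (f : S -> T) (g : T -> S),
    [/\ {within A, continuous f}, {within B, continuous g},
        forall x, A x -> B (f x) /\ g (f x) = x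
      & forall y, B y -> A (g y) /\ f (g y) = y].

(* Surfaces are closed: compact, connected and without boundary. Second
   countability follows from compactness and is not listed. *)
Definition is_surface (R : realType) (M : topologicalType) : Prop :=
  [/\ [set: M] !=set0, hausdorff_space M, compact [set: M],
      connected [set: M]
    & forall x : M, exists U : set M,
        [/\ open U, U x & homeomorphic U (@open_disc R)]].

Definition is_complex (W : finType) (K : {set {set W}}) : Prop :=
  finset.set0 \notin K /\
  forall A B : {set W}, A \in K -> B \subset A -> B != finset.set0 -> B \in K.

(* |K| in barycentric coordinates. *)
Definition realization (R : realType) (W : finType) (K : {set {set W}}) :
    set {ptws W -> R} :=
  [set p | [/\ forall w, 0 <= p w, \sum_(w : W) p w = 1
             & [set w | p w != 0]%SET \in K]].

Arguments realization R {W} K.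

(* O a b c says that the 2-simplex {a, b, c} carries the cyclic order (a b c)
   and so induces the direction a -> b on the edge {a, b}. The last clause says
   that two triangles with a common edge induce opposite directions on it. *)
Definition coherent_orientation (W : finType) (K : {set {set W}})
    (O : W -> W -> W -> bool) : Prop :=
  [/\ forall a b c, O a b c ->
        [/\ uniq [:: a; b; c], [set a; b; c]%SET \in K, O b c a & ~~ O b a c],
      forall a b c, uniq [:: a; b; c] -> [set a; b; c]%SET \in K ->
        O a b c || O b a c
    & forall a b c d, O a b c -> O a b d -> c = d].

(* Every closed surface has a triangulation, and either all of its
   triangulations or none can be oriented coherently. *)
Definition orientable (R : realType) (M : topologicalType) : Prop :=
  exists (W : finType) (K : {set {set W}}) (O : W -> W -> W -> bool),
    [/\ is_complex K, homeomorphic (realization R K) [set: M]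
      & coherent_orientation K O].

Definition graph_edges (V : finType) (e : rel V) : {set {set V}} :=
  [set [set x.1; x.2] | x : V * V & e x.1 x.2]%SET.

Definition graph_complex (V : finType) (e : rel V) : {set {set V}} :=
  ([set [set v] | v : V] :|: graph_edges e)%SET.

Definition graph_space (R : realType) (V : finType) (e : rel V) :
    set {ptws V -> R} :=
  realization R (graph_complex e).

Arguments graph_space R {V} e.

Definition complete_multipartite (q r : nat) : rel ('I_q * 'I_r) :=
  fun x y => x.1 != y.1.

(* The circuit v_0, v_1, ..., v_{l-1}, v_0 is the sequence of the v_k; ordS is
   the cyclic successor on indices. *)
Definition circuit_edges (V : finType) (c : seq V) : seq {set V} :=
  [seq [set tnth (in_tuple c) k; tnth (in_tuple c) (ordS k)]%SET
     | k <- enum 'I_(size c)].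

Definition is_circuit (V : finType) (e : rel V) (c : seq V) : Prop :=
  [/\ c != [::], cycle e c & uniq (circuit_edges c)].

Definition circuit_decomposition (V : finType) (e : rel V) (D : seq (seq V)) :
    Prop :=
  (forall c, c \in D -> is_circuit e c) /\
  perm_eq (flatten [seq circuit_edges c | c <- D]) (enum (graph_edges e)).

Definition is_embedding (R : realType) (V : finType) (e : rel V)
    (M : topologicalType) (phi : {ptws V -> R} -> M) : Prop :=
  {within graph_space R e, continuous phi} /\ set_inj (graph_space R e) phi.

Definition faces (R : realType) (V : finType) (e : rel V)
    (M : topologicalType) (phi : {ptws V -> R} -> M) : set (set M) :=
  let U := ~` (phi @` graph_space R e) in
  [set connected_component U x | x in U].

Definition cellular (R : realType) (V : finType) (e : rel V)
    (M : topologicalType) (phi : {ptws V -> R} -> M) : Prop :=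
  forall F, faces e phi F -> homeomorphic F (@open_disc R).

(* The point (1 - t) u + t v of the graph. *)
Definition edge_point (R : realType) (V : finType) (u v : V) (t : R) :
    {ptws V -> R} :=
  fun w => (1 - t) * (w == u)%:R + t * (w == v)%:R.

(* The face F is the bijective image of the open disc under a continuous map of
   the closed disc whose restriction to the unit circle runs once along c, the
   k-th of size c equal arcs being mapped to the k-th edge of c. *)
Definition face_boundary (R : realType) (V : finType)
    (M : topologicalType) (phi : {ptws V -> R} -> M) (F : set M) (c : seq V) :
    Prop :=
  exists g : R * R -> M,
    [/\ {within @closed_disc R, continuous g},
        set_bij (@open_disc R) F g
      & forall (k : 'I_(size c)) (t : R), 0 <= t <= 1 ->
          let a := 2 * pi * (k%:R + t) / (size c)%:R in
          g (cos a, sin a)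
            = phi (edge_point (tnth (in_tuple c) k)
                              (tnth (in_tuple c) (ordS k)) t)].

Definition share_edge (R : realType) (V : finType) (e : rel V)
    (M : topologicalType) (phi : {ptws V -> R} -> M) (F G : set M) : Prop :=
  exists u v : V, e u v /\
    forall t : R, 0 <= t <= 1 ->
      (closure F `&` closure G) (phi (edge_point u v t)).

Definition face_coloring (R : realType) (V : finType) (e : rel V)
    (M : topologicalType) (phi : {ptws V -> R} -> M) (col : set M -> bool) :
    Prop :=
  forall F G, faces e phi F -> faces e phi G -> F <> G ->
    share_edge e phi F G -> col F != col G.

Definition boundaries_are (R : realType) (V : finType)
    (M : topologicalType) (phi : {ptws V -> R} -> M)
    (C : set (set M)) (D : seq (seq V)) : Prop :=
  exists f : 'I_(size D) -> set M,
    set_bij [set: 'I_(size D)] C f /\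
    forall i, face_boundary phi (f i) (tnth (in_tuple D) i).

Definition is_biembedding_of (R : realType) (V : finType) (e : rel V)
    (M : topologicalType) (phi : {ptws V -> R} -> M) (D D' : seq (seq V)) :
    Prop :=
  is_embedding e phi /\
  exists col : set M -> bool,
    [/\ face_coloring e phi col,
        boundaries_are phi [set F | faces e phi F /\ col F] D
      & boundaries_are phi [set F | faces e phi F /\ ~~ col F] D'].

Definition is_biembedding (R : realType) (V : finType) (e : rel V)
    (M : topologicalType) (phi : {ptws V -> R} -> M) : Prop :=
  exists D D' : seq (seq V),
    [/\ circuit_decomposition e D, circuit_decomposition e D'
      & is_biembedding_of e phi D D'].

Definition face_length (R : realType) (V : finType) (e : rel V)
    (M : topologicalType) (phi : {ptws V -> R} -> M) (F : set M) (l : nat) :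
    Prop :=
  exists c : seq V, [/\ is_circuit e c, face_boundary phi F c & size c = l].

(* Main.v *)
From HB Require Import structures.
Require Import Defs.
From mathcomp Require Import all_boot all_order all_algebra.
From mathcomp Require Import all_classical all_reals all_analysis.
From mathcomp Require Import zify ring lra.

(* Let p = 2n+1 and N = n^2, and let s_0, ..., s_(N-1) contain exactly one
   element of each pair {x, -x} of elements of G = Z_p x Z_n outside the
   subgroup {0} x Z_n, so that the graph is the Cayley graph of {s_i, -s_i}.
   Direct the edges as (g, i) : g -> g + s_i with i in Z_N. Follow (g, i) by
   (g + s_i, i + 1) along black faces and by (g + s_i, i + 2) along white ones.
   The quotient of the two rules permutes the N edges entering a vertex
   cyclically, so this is an oriented surface with a face 2-colouring. As N is
   odd, each rule returns to the index i after N steps, and g has then moved by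
   sum s_i. If sum s_i generates G, there is a single face of each colour, of
   length N |G|. Starting from {1, ..., n} x Z_n and changing the sign of (n, 1)
   yields such a half set: the first component of the sum is 17/16 mod p, which
   vanishes only for p = 17, that is for an even n.

   The surface is realized as the polyhedron of a simplicial complex in which
   every link is a cycle, so that open stars are open discs; a face is a cone
   over a cycle surrounded by an annulus reaching to its boundary circuit. *)

Set Implicit Arguments.
Unset Strict Implicit.
Unset Printing Implicit Defensive.

Import Order.TTheory GRing.Theory Num.Theory.
Import numFieldNormedType.Exports.

Local Open Scope classical_set_scope.
Local Open Scope ring_scope.

(** * Compactness and quotient maps *)

(** The definitions are topological, which shapes the proof in three ways. Homeomorphisms come from
    comparing two continuous maps with the same fibres on one compact rectangle, so that no inverse
    is shown continuous by hand. A face boundary may pass through a graph vertex several times, so a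
    cone over it need not be a simplicial complex; a ring of new vertices, one per step of the
    boundary walk, keeps the centre away from the graph. And [face_length] admits any circuit
    bounding the face, not only the constructed one.

    The constant 17/16: modulo p one has n = -1/2 and n + 1 = 1/2, so the first component of the sum
    over {1, ..., n} x Z_n is n^2 (n + 1) / 2 = 1/16, and the sign change subtracts 2n = -1. The
    second component is 0 before the change and -2 after it, a generator of Z_n because n is odd. As
    p and n are coprime, an element that generates in both factors generates G. *)

Lemma continuous_factor (S T U : topologicalType) (C : set S) (B : set T)
    (q : S -> T) (P : S -> U) (g : T -> U) :
  hausdorff_space T -> compact C ->
  {within C, continuous q} -> {within C, continuous P} ->
  B `<=` q @` C -> (forall x, C x -> B (q x) -> g (q x) = P x) ->
  {within B, continuous g}.
Proof.
move=> hT cC cq cP BqC gqP; apply/subspace_continuousP => y By O.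
rewrite nbhsE => -[D [oD Dgy] DO].
have /closed_subspaceP[V clV VC] : closed (P @^-1` (~` D) : set (subspace C)).
  by apply: closed_comp => [x _|]; [exact: cP|exact: open_closedC].
(* As C is compact and T is Hausdorff, [q] is a closed map: the points of C that [P] sends outside D
   have a closed image, which misses [y], and its complement is the required neighbourhood. *)
pose Z := V `&` C.
have cZ : compact Z by rewrite /Z setIC; exact: compact_closedI.
have clqZ : closed (q @` Z).
  apply: compact_closed => //; apply: continuous_compact => //.
  by apply: continuous_subspaceW cq; rewrite /Z => x [].
have nqZy : ~ (q @` Z) y.
  move=> [x]; rewrite /Z VC => -[/= nO Cx] qxy; apply: nO.
  by rewrite -gqP ?qxy.
have : nbhs y (~` (q @` Z)) by apply: open_nbhs_nbhs; split=> //; exact: closed_openC.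
rewrite /= !nbhs_simpl; rewrite /within /=.
apply: filterS => t nt Bt; apply: DO.
have [x Cx qxt] := BqC _ Bt.
rewrite -qxt /from_subspace gqP ?qxt //; apply: contrapT => nO.
by apply: nt; exists x => //; rewrite /Z VC.
Qed.

Lemma homeomorphic_images (S T U : topologicalType) (C A : set S)
    (P : S -> T) (q : S -> U) :
  hausdorff_space T -> hausdorff_space U -> compact C ->
  {within C, continuous P} -> {within C, continuous q} ->
  A `<=` C -> A !=set0 ->
  (forall x y, C x -> A y -> P x = P y -> A x) ->
  (forall x y, C x -> A y -> q x = q y -> A x) ->
  (forall x y, A x -> A y -> P x = P y <-> q x = q y) ->
  homeomorphic (P @` A) (q @` A).
Proof.
move=> hT hU cC cP cq AC [a0 Aa0] satP satq Pq.
(* [k] is an arbitrary section of [h], in general discontinuous; only the composites of a section of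
   one map with the other map are continuous. *)
have lift (V : Type) (h : S -> V) :
    exists k : V -> S, forall x, A x -> A (k (h x)) /\ h (k (h x)) = h x.
  exists (fun v => xget a0 [set x | A x /\ h x = v]) => x Ax.
  suff : [set y | A y /\ h y = h x] (xget a0 [set y | A y /\ h y = h x]) by [].
  by apply: xgetPex; exists x.
have [kP kPE] := lift _ P; have [kq kqE] := lift _ q.
have qkP x : A x -> q (kP (P x)) = q x.
  by move=> Ax; apply/(Pq (kP (P x)) x) => //; have [] := kPE _ Ax.
have Pkq x : A x -> P (kq (q x)) = P x.
  by move=> Ax; apply/(Pq (kq (q x)) x) => //; have [] := kqE _ Ax.
exists (q \o kP), (P \o kq); split.
- apply: (continuous_factor hT cC cP cq) => [_ [x Ax <-]|x Cx [y Ay /esym Pxy]].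
    by exists x => //; exact: AC.
  by rewrite /= qkP //; exact: satP Pxy.
- apply: (continuous_factor hU cC cq cP) => [_ [x Ax <-]|x Cx [y Ay /esym qxy]].
    by exists x => //; exact: AC.
  by rewrite /= Pkq //; exact: satq qxy.
- move=> _ [x Ax <-] /=; split; last by rewrite qkP // Pkq.
  by rewrite qkP //; exists x.
- move=> _ [x Ax <-] /=; split; last by rewrite Pkq // qkP.
  by rewrite Pkq //; exists x.
Qed.

Lemma quotient_map_factor (S T U : topologicalType) (C : set S) (q : S -> T)
    (P : S -> U) (u0 : U) :
  hausdorff_space T -> compact C ->
  {within C, continuous q} -> {within C, continuous P} ->
  (forall x y, C x -> C y -> q x = q y -> P x = P y) ->
  exists g : T -> U,
    {within q @` C, continuous g} /\ forall x, C x -> g (q x) = P x.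
Proof.
move=> hT cC cq cP qP.
pose g y := xget u0 [set u | exists x, [/\ C x, q x = y & P x = u]].
have gE x : C x -> g (q x) = P x.
  move=> Cx; have : exists u, [set u | exists y, [/\ C y, q y = q x & P y = u]] u.
    by exists (P x), x.
  by move=> /(xgetPex u0)[y [Cy qyx Py]]; rewrite -(qP _ _ Cy Cx qyx) Py.
exists g; split => //.
by apply: (continuous_factor hT cC cq cP) => // x Cx _; exact: gE.
Qed.

Lemma continuous_into_prod (T : topologicalType) (I : Type)
    (K : topologicalType) (f : T -> {ptws I -> K}) :
  (forall i, continuous (fun x => f x i)) -> continuous f.
Proof.
move=> cf x; apply/cvg_sup => i; apply/cvg_image.
  by rewrite eqEsubset; split=> // y _; exists (fun=> y).
move=> Q nQ; exists ((fun x => x i) @^-1` Q); last first.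
  rewrite eqEsubset; split=> [y [z Qz <-] //|y Qy].
  by exists (fun=> y).
exact: (cf i x Q nQ).
Qed.

(** * Polar coordinates on the disc *)

Section Polar.
Variable R : realType.
Implicit Types (m : nat) (x y : R * R).

(** The second coordinate counts angle in m-ths of a turn, so that sectors of a star and arcs of a
    face boundary become unit intervals. *)
Definition rect m : set (R * R) := `[0, 1] `*` `[0, m%:R].

Definition polar m x : R * R :=
  (x.1 * cos (2 * pi * x.2 / m%:R), x.1 * sin (2 * pi * x.2 / m%:R)).

(** The fibres of [polar m] on the rectangle: one side collapses to the centre and two sides are
    glued. *)
Definition same_polar m x y : Prop :=
  x.1 = y.1 /\
  [\/ x.1 = 0, x.2 = y.2, x.2 = 0 /\ y.2 = m%:R | x.2 = m%:R /\ y.2 = 0].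

Lemma rectP m x : rect m x <-> 0 <= x.1 <= 1 /\ 0 <= x.2 <= m%:R.
Proof. by rewrite /rect /setX /= !in_itv /=. Qed.

Lemma rect_compact m : compact (rect m).
Proof. by apply: compact_setX; exact: segment_compact. Qed.

Lemma polar_continuous m : continuous (polar m).
Proof.
have c2 : continuous (fun x : R * R => 2 * pi * x.2 / m%:R).
  move=> x; apply: cvgM; last exact: cvg_cst.
  by apply: cvgM; [exact: cvg_cst|exact: cvg_snd].
have cc : continuous (fun x : R * R => x.1 * cos (2 * pi * x.2 / m%:R)).
  move=> x; apply: cvgM; first exact: cvg_fst.
  by apply: continuous_comp; [exact: c2|exact: continuous_cos].
have cs : continuous (fun x : R * R => x.1 * sin (2 * pi * x.2 / m%:R)).
  move=> x; apply: cvgM; first exact: cvg_fst.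
  by apply: continuous_comp; [exact: c2|exact: continuous_sin].
by move=> x; exact: cvg_pair (cc x) (cs x).
Qed.

Lemma polar_norm m x : (polar m x).1 ^+ 2 + (polar m x).2 ^+ 2 = x.1 ^+ 2.
Proof. by rewrite /polar /= !exprMn -mulrDr cos2Dsin2 mulr1. Qed.

(** Since cos t = 1 - 2 sin^2 (t/2), the half angle has sine zero, while sine is positive inside ]0,
    pi[. *)
Lemma cos_eq1 (t : R) : 0 <= t <= 2 * pi -> cos t = 1 -> t = 0 \/ t = 2 * pi.
Proof.
move=> /andP[t0 t2] ct.
have s0 : sin (t / 2) = 0.
  have : cos (t / 2 + t / 2) = 1 by rewrite -splitr.
  rewrite cosD -!expr2 cos2sin2 => h.
  by apply/eqP; rewrite -sqrf_eq0; apply/eqP; lra.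
have [->|tn0] := eqVneq t 0; first by left.
have [->|tn2] := eqVneq t (2 * pi); first by right.
suff : 0 < sin (t / 2) by rewrite s0 ltxx.
have t0' : 0 < t by rewrite lt_def tn0.
have t2' : t < 2 * pi by rewrite lt_def eq_sym tn2.
by apply: sin_gt0_pi; apply/andP; split; lra.
Qed.

Lemma angle_inj m (s t : R) : (0 < m)%N -> 0 <= s <= m%:R -> 0 <= t <= m%:R ->
  cos (2 * pi * s / m%:R) = cos (2 * pi * t / m%:R) ->
  sin (2 * pi * s / m%:R) = sin (2 * pi * t / m%:R) ->
  [\/ s = t, s = 0 /\ t = m%:R | s = m%:R /\ t = 0].
Proof.
move=> m0; wlog st : s t / s <= t.
  move=> H s0m t0m cst sst; have [st|/ltW ts] := leP s t; first exact: H.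
  have [->|[-> ->]|[-> ->]] := H t s ts t0m s0m (esym cst) (esym sst).
  - by constructor 1.
  - by constructor 3.
  - by constructor 2.
move=> /andP[s0 sm] /andP[t0 tm] cst sst.
have mR0 : 0 < m%:R :> R by rewrite ltr0n.
have mRn0 := lt0r_neq0 mR0.
have pi20 : 0 < 2 * pi :> R by rewrite mulr_gt0 ?pi_gt0.
have E : 2 * pi * (t - s) / m%:R = 2 * pi * t / m%:R - 2 * pi * s / m%:R.
  by rewrite mulrBr mulrBl.
have : cos (2 * pi * (t - s) / m%:R) = 1.
  by rewrite E cosB cst sst -!expr2 cos2Dsin2.
case/cos_eq1.
- apply/andP; split.
    by rewrite divr_ge0 ?(ltW mR0) // mulr_ge0 ?(ltW pi20) // subr_ge0.
  by rewrite ler_pdivrMr // ler_pM2l //; lra.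
- move=> /eqP; rewrite mulf_eq0 invr_eq0 (negPf mRn0) orbF mulf_eq0.
  by rewrite (gt_eqF pi20) /= subr_eq0 => /eqP ->; constructor 1.
- move=> /(canRL (mulfVK mRn0)) /(mulfI (lt0r_neq0 pi20)) tsm.
  by constructor 2; lra.
Qed.

Lemma polarE m x y : (0 < m)%N -> rect m x -> rect m y ->
  polar m x = polar m y <-> same_polar m x y.
Proof.
move=> m0 /rectP[/andP[x10 x11] x2m] /rectP[/andP[y10 y11] y2m].
have mRn0 : m%:R != 0 :> R by rewrite pnatr_eq0 -lt0n.
split=> [pxy|[x1y1 /=]]; last first.
  have c0 : cos (2 * pi * 0 / m%:R) = cos (2 * pi * m%:R / m%:R) :> R.
    by rewrite mulfK // mulr0 mul0r cos0 mulr2n mulrDl mul1r cosDpi cospi opprK.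
  have s0 : sin (2 * pi * 0 / m%:R) = sin (2 * pi * m%:R / m%:R) :> R.
    by rewrite mulfK // mulr0 mul0r sin0 mulr2n mulrDl mul1r sinDpi sinpi oppr0.
  rewrite /polar -x1y1.
  by case=> [->|->|[-> ->]|[-> ->]]; rewrite ?mul0r ?c0 ?s0.
have x1y1 : x.1 = y.1.
  have := polar_norm m x; rewrite pxy polar_norm => yx.
  by apply/esym/eqP; rewrite -(@eqrXn2 _ 2) // yx.
split=> //; have [x1_0|x1n0] := eqVneq x.1 0; first by constructor 1.
case: pxy; rewrite -x1y1 => /(mulfI x1n0) cxy /(mulfI x1n0) sxy.
have [|[? ?]|[? ?]] := angle_inj m0 x2m y2m cxy sxy.
- by constructor 2.
- by constructor 3.
- by constructor 4.
Qed.

Lemma polar_image m : (0 < m)%N -> polar m @` rect m = @closed_disc R.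
Proof.
move=> m0; have mR0 : 0 < m%:R :> R by rewrite ltr0n.
have mRn0 := lt0r_neq0 mR0.
rewrite eqEsubset; split=> [_ [x /rectP[/andP[x0 x1] _] <-]|[u v] uv].
  by rewrite /closed_disc /= polar_norm expr_le1.
rewrite /closed_disc /= in uv.
pose r := Num.sqrt (u ^+ 2 + v ^+ 2).
have r2 : r ^+ 2 = u ^+ 2 + v ^+ 2 by rewrite sqr_sqrtr // addr_ge0 ?sqr_ge0.
have r0 : 0 <= r by exact: sqrtr_ge0.
have r1 : r <= 1 by rewrite -(@expr_le1 _ 2) // r2.
have pi0 : 0 < pi :> R by exact: pi_gt0.
have [rE|rn0] := eqVneq r 0.
  exists (0, 0); first by apply/rectP; rewrite /= lexx ler01 ltW.
  move: r2; rewrite rE expr0n /= => /esym/eqP.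
  rewrite paddr_eq0 ?sqr_ge0 // !sqrf_eq0 => /andP[/eqP -> /eqP ->].
  by rewrite /polar /= !mul0r.
suff [a a02 [ca sa]] : exists2 a, 0 <= a <= 2 * pi & r * cos a = u /\ r * sin a = v.
  have aE : 2 * pi * (m%:R * a / (2 * pi)) / m%:R = a.
    by move: (pi : R) pi0 => p /lt0r_neq0 p0; field; rewrite mRn0 p0.
  exists (r, m%:R * a / (2 * pi)); last by rewrite /polar /= aE ca sa.
  apply/rectP; rewrite /= r0 r1; split=> //.
  case/andP: a02 => a0 a2; apply/andP; split.
    by apply: divr_ge0; apply: mulr_ge0; rewrite ?(ltW pi0) ?(ltW mR0).
  by rewrite ler_pdivrMr ?mulr_gt0 // ler_pM2l.
have ur : -1 <= u / r <= 1.
  rewrite -ler_norml normrM normfV (ger0_norm r0) ler_pdivrMr ?lt_def ?rn0 // mul1r.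
  by rewrite -(@ler_pXn2r _ 2) ?nnegrE // real_normK ?num_real // r2; have := sqr_ge0 v; lra.
have sE : Num.sqrt (1 - (u / r) ^+ 2) = `|v| / r.
  rewrite -{2}(ger0_norm r0) -normf_div -sqrtr_sqr.
  by congr Num.sqrt; rewrite !expr_div_n r2; field; rewrite -r2 expf_neq0.
have [v0|v0] := leP 0 v.
  exists (acos (u / r)).
    by rewrite acos_ge0 //=; have := @acos_lepi _ _ ur; lra.
  rewrite acosK // sin_acos // sE ger0_norm //.
  by split; field.
have aE (f : R -> R) : f (2 * pi - acos (u / r)) = f (- acos (u / r) + pi *+ 2).
  by rewrite addrC mulr_natl.
(* In the lower half plane the arc cosine is reflected, so as to stay within [0, 2 pi]. *)
exists (2 * pi - acos (u / r)).
  by have := @acos_lepi _ _ ur; have := @acos_ge0 _ _ ur; lra.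
rewrite (aE cos) (aE sin) cosD2pi sinD2pi cosN sinN acosK // sin_acos // sE.
by rewrite ltr0_norm //; split; field.
Qed.

Lemma polar_image_open m : (0 < m)%N ->
  polar m @` (rect m `&` [set x | x.1 < 1]) = @open_disc R.
Proof.
move=> m0; rewrite eqEsubset; split=> [_ [x [/rectP[/andP[x0 _] _] x1] <-]|z z1].
  by rewrite /open_disc /= polar_norm expr_lt1.
have : closed_disc z by exact: ltW.
rewrite -(polar_image m0) => -[x rx pxz]; exists x => //; split=> //=.
have /rectP[/andP[x0 _] _] := rx.
by rewrite -(@expr_lt1 _ 2) // -[x.1 ^+ 2](polar_norm m) pxz.
Qed.

End Polar.

(** * Piecewise linear loops *)

Lemma periodic_inj (R : realType) (T : Type) (m : nat) (f : R -> T) :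
  (0 < m)%N -> f m%:R = f 0 ->
  (forall s t, 0 <= s < m%:R -> 0 <= t < m%:R -> f s = f t -> s = t) ->
  forall s t, 0 <= s <= m%:R -> 0 <= t <= m%:R -> f s = f t ->
  [\/ s = t, s = 0 /\ t = m%:R | s = m%:R /\ t = 0].
Proof.
move=> m0 fm f_inj s t /andP[s0 sm] /andP[t0 tm] st.
have mR : 0 < m%:R :> R by rewrite ltr0n.
have [sE|sn] := eqVneq s m%:R; have [tE|tn] := eqVneq t m%:R.
- by constructor 1; rewrite sE.
- constructor 3; split=> //; apply: f_inj; rewrite ?lexx ?t0 //=.
    by rewrite lt_def eq_sym tn.
  by rewrite -st sE fm.
- constructor 2; split=> //; apply: f_inj; rewrite ?lexx ?s0 //=.
    by rewrite lt_def eq_sym sn.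
  by rewrite st tE fm.
- by constructor 1; apply: f_inj; rewrite ?s0 ?t0 //= lt_def eq_sym ?sn ?tn.
Qed.

Section PiecewiseLinearLoops.
Variables (R : realType) (W : eqType) (m : nat) (c : nat -> W).

(** A bump supported in [-1, 1] and translated to every integer is seen from k + x only at k and k +
    1. This turns the global sums, whose continuity is evident, into two-term formulas on each
    sector. *)
Lemma sum_window (F : R -> R) (g : nat -> R) (k : nat) (x : R) :
  (forall z, 1 <= `|z| -> F z = 0) -> (k < m)%N -> 0 <= x <= 1 ->
  \sum_(j < m.+1) F (k%:R + x - j%:R) * g j = F x * g k + F (x - 1) * g k.+1.
Proof.
move=> F0 km /andP[x0 x1].
have k1 : (k < m.+1)%N by lia.
have k2 : (k.+1 < m.+1)%N by lia.
rewrite (bigD1 (Ordinal k1)) //= (bigD1 (Ordinal k2)) /=; last first.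
  by rewrite -val_eqE /= -addn1; lia.
rewrite big1 ?addr0 => [|j /andP[jk jk1]].
  by rewrite addrAC subrr add0r -natr1 opprD addrACA subrr add0r.
rewrite F0 ?mul0r //; rewrite -!val_eqE /= in jk jk1.
have [jlt|jge] := ltnP j k.
  have : j.+1%:R <= k%:R :> R by rewrite ler_nat.
  by rewrite -natr1 => jk'; rewrite ger0_norm; lra.
have : k.+2%:R <= j%:R :> R by rewrite ler_nat; lia.
by rewrite -!natr1 => kj; rewrite ler0_norm; lra.
Qed.

Definition tent (z : R) : R := Num.max 0 (1 - `|z|).

(** Barycentric coordinates of the polygonal path through [c 0], ..., [c m]. The index [m] is
    included so that the last side ends at [c m], which equals [c 0] for a closed path. *)
Definition loop (s : R) (u : W) : R :=
  \sum_(j < m.+1) tent (s - j%:R) * (u == c j)%:R.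

Lemma loopE k x u : (k < m)%N -> 0 <= x <= 1 ->
  loop (k%:R + x) u = (1 - x) * (u == c k)%:R + x * (u == c k.+1)%:R.
Proof.
move=> km x01; rewrite /loop (sum_window (F := tent) (fun j => (u == c j)%:R) _ km x01).
  case/andP: x01 => x0 x1; rewrite /tent ger0_norm // ler0_norm ?subr_le0 //.
  by rewrite !max_r; [congr (_ * _ + _ * _); lra|lra|lra].
by move=> z z1; rewrite /tent max_l //; lra.
Qed.

Lemma nat_frac_lt (s : R) : 0 <= s < m%:R ->
  exists k x, [/\ (k < m)%N, 0 <= x < 1 & s = k%:R + x].
Proof.
move=> /andP[s0 sm]; exists (Num.truncn s), (s - (Num.truncn s)%:R).
have /andP[ts st] := truncn_itv s0.
split; last by lra.
  by rewrite -(ltr_nat R); exact: le_lt_trans sm.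
by move: st; rewrite -natr1; lra.
Qed.

Lemma nat_frac (s : R) : (0 < m)%N -> 0 <= s <= m%:R ->
  exists k x, [/\ (k < m)%N, 0 <= x <= 1 & s = k%:R + x].
Proof.
move=> m0 /andP[s0 sm]; have [smE|smn] := eqVneq s m%:R.
  exists m.-1, 1; split; [by rewrite prednK|by rewrite ler01 lexx|].
  by rewrite natr1 prednK.
have /nat_frac_lt[k [x [km /andP[x0 x1] ->]]] : 0 <= s < m%:R.
  by rewrite s0 lt_def eq_sym smn.
by exists k, x; split=> //; rewrite x0 ltW.
Qed.

Hypothesis m3 : (2 < m)%N.
Hypothesis c_closed : c m = c 0.
Hypothesis c_inj : forall i j, (i < m)%N -> (j < m)%N -> c i = c j -> i = j.

Lemma closed_eqS i j : (i < m)%N -> (j < m)%N -> c i = c j.+1 ->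
  i = j.+1 \/ i = 0 /\ j.+1 = m.
Proof.
move=> im jm; have [jE|jn] := eqVneq j.+1 m.
  by rewrite jE c_closed => /c_inj ->; [right|lia|lia].
by move=> /c_inj ->; [left|lia|lia].
Qed.

Lemma closed_neqS i : (i < m)%N -> c i != c i.+1.
Proof. by move=> im; apply/eqP => /(closed_eqS im im); lia. Qed.

(** If i and j differed, then i = j + 1 and j = i + 1 modulo m, so that m would divide 2. *)
Lemma closed_adj i j : (i < m)%N -> (j < m)%N ->
  c i = c j \/ c i = c j.+1 -> c j = c i \/ c j = c i.+1 -> i = j.
Proof.
move=> im jm [/c_inj ->|/closed_eqS ij] // [/c_inj ->|/closed_eqS ji] //.
by have := ij im jm; have := ji jm im; lia.
Qed.

(** At k + x with x < 1 the coordinate at [c k] is positive, so [c k] is an end of the other side as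
    well; by symmetry the sides agree, and then x is read off that coordinate. *)
Lemma loop_inj_lt (s t : R) : 0 <= s < m%:R -> 0 <= t < m%:R ->
  loop s =1 loop t -> s = t.
Proof.
move=> /nat_frac_lt[k [x [km /andP[x0 x1] ->]]].
move=> /nat_frac_lt[l [y [lm /andP[y0 y1] ->]]] st.
have E u : (1 - x) * (u == c k)%:R + x * (u == c k.+1)%:R =
           (1 - y) * (u == c l)%:R + y * (u == c l.+1)%:R.
  by rewrite -!loopE ?x0 ?y0 ?ltW.
have kl : k = l.
  apply: closed_adj => //.
    have := E (c k); rewrite eqxx (negPf (closed_neqS km)) mulr0 addr0 mulr1.
    case: eqP => [->|_]; first by left.
    by case: eqP => [->|_]; [right|rewrite mulr0n !mulr0 addr0 => h; exfalso; lra].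
  have := E (c l); rewrite eqxx (negPf (closed_neqS lm)) mulr0 addr0 mulr1.
  case: eqP => [->|_]; first by left.
  by case: eqP => [->|_]; [right|rewrite mulr0n !mulr0 addr0 => h; exfalso; lra].
rewrite -kl in E *; have := E (c k).
by rewrite eqxx (negPf (closed_neqS km)) !mulr0 !addr0 !mulr1 => h; congr (_ + _); lra.
Qed.

Lemma loop_closed u : loop m%:R u = loop 0 u.
Proof.
have -> : m%:R = m.-1%:R + 1 :> R by rewrite natr1 prednK //; lia.
have <- : 0%:R + 0 = 0 :> R by rewrite addr0.
rewrite !loopE ?lexx ?ler01 //; try lia.
by rewrite prednK ?c_closed; [lra|lia].
Qed.

Lemma loop_inj (s t : R) : 0 <= s <= m%:R -> 0 <= t <= m%:R ->
  loop s =1 loop t -> [\/ s = t, s = 0 /\ t = m%:R | s = m%:R /\ t = 0].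
Proof.
move=> s0m t0m st; apply: (@periodic_inj _ _ m loop) => //; first by lia.
- by apply/funext => u; exact: loop_closed.
- by move=> x y x0m y0m xy; apply: loop_inj_lt => // u; rewrite xy.
- exact/funext.
Qed.

End PiecewiseLinearLoops.

Arguments loop {R W}.

Lemma continuous_bigsum (R : realType) (T : topologicalType) (I : Type)
    (r : seq I) (f : I -> T -> R) :
  (forall i, continuous (f i)) -> continuous (fun x => \sum_(i <- r) f i x).
Proof.
move=> cf; elim: r => [|i r IH].
  by under eq_fun do rewrite big_nil; move=> x; exact: cvg_cst.
under eq_fun do rewrite big_cons.
by move=> x; apply: cvgD; [exact: cf|exact: IH].
Qed.

Lemma tent_continuous (R : realType) : continuous (@tent R).
Proof.
move=> z; apply: (@continuous_max _ _ (fun=> 0) (fun z : R => 1 - `|z|)).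
  exact: cvg_cst.
by apply: cvgB; [exact: cvg_cst|exact: norm_continuous].
Qed.

Lemma loop_continuous (R : realType) (W : eqType) m (c : nat -> W) u :
  continuous (fun s : R => loop m c s u).
Proof.
apply: continuous_bigsum => j s; apply: cvgM; last exact: cvg_cst.
apply: (@continuous_comp _ _ _ (fun s : R => s - j%:R) (@tent R)).
  by apply: cvgB; [exact: cvg_id|exact: cvg_cst].
exact: tent_continuous.
Qed.

(** * Simplicial complexes given by cyclic links *)

(* [lk w] lists the link of [w] as a closed cycle of length [sz w]; consecutive
   entries span with [w] a positively oriented triangle. *)
Record links (W : finType) := Links {
  sz : W -> nat;
  lk : W -> nat -> W;
  sz_gt2 : forall w, (2 < sz w)%N;
  lk_closed : forall w, lk w (sz w) = lk w 0;
  lk_inj : forall w i j, (i < sz w)%N -> (j < sz w)%N ->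
    lk w i = lk w j -> i = j;
  lk_neq : forall w i, (i < sz w)%N -> lk w i != w;
  lk_rot : forall w i, (i < sz w)%N ->
    exists2 j, (j < sz (lk w i))%N &
      lk (lk w i) j = lk w i.+1 /\ lk (lk w i) j.+1 = w }.

Section Complex.
Variables (W : finType) (K : links W).
Implicit Types (a b c d w : W) (A : {set W}).

Definition tri a b c : bool :=
  [exists k : 'I_(sz K a), (lk K a k == b) && (lk K a k.+1 == c)].

Lemma triP a b c :
  reflect (exists2 k, (k < sz K a)%N & lk K a k = b /\ lk K a k.+1 = c) (tri a b c).
Proof.
apply: (iffP existsP) => [[k /andP[/eqP kb /eqP kc]]|[k ka [kb kc]]].
  by exists k.
by exists (Ordinal ka); rewrite /= kb kc !eqxx.
Qed.

Lemma tri_rot a b c : tri a b c -> tri b c a.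
Proof.
by move=> /triP[k ka [<- <-]]; apply/triP; have [j] := lk_rot ka; exists j.
Qed.

Lemma tri_neq a b c : tri a b c -> a != b.
Proof. by move=> /triP[k ka [<- _]]; rewrite eq_sym lk_neq. Qed.

Lemma tri_uniq a b c : tri a b c -> uniq [:: a; b; c].
Proof.
move=> abc; have bca := tri_rot abc; have cab := tri_rot bca.
by rewrite /= !inE negb_or (tri_neq abc) (tri_neq bca) eq_sym (tri_neq cab).
Qed.

Lemma tri_fun a b c d : tri a b c -> tri a b d -> c = d.
Proof.
by move=> /triP[k ka [<- <-]] /triP[l la [/(lk_inj la ka) -> <-]].
Qed.

(** Otherwise the link of [a] would run both from b to c and from c to b, which a cycle of length at
    least 3 cannot do. *)
Lemma tri_asym a b c : tri a b c -> ~~ tri b a c.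
Proof.
move=> abc; apply/negP => /tri_rot.
case/triP: abc => k ka [<- <-] /triP[l la [lE lE1]].
have kl : k = l.
  apply: (closed_adj (sz_gt2 K a) (lk_closed K a) (@lk_inj _ K a)) => //.
    by right; rewrite lE1.
  by right; rewrite lE.
have := closed_neqS (sz_gt2 K a) (lk_closed K a) (@lk_inj _ K a) ka.
by rewrite -{1}lE1 -kl eqxx.
Qed.

Definition cplx : {set {set W}} :=
  [set A : {set W} | (A != finset.set0) &&
    [exists a, exists b, exists c, tri a b c && (A \subset [set a; b; c])]]%SET.

Lemma cplxP A : reflect
  (A != finset.set0 /\ exists a b c, tri a b c /\ A \subset [set a; b; c]%SET)
  (A \in cplx).
Proof.
rewrite inE; apply: (iffP andP) => [[A0]|[A0]].
  by move=> /existsP[a /existsP[b /existsP[c /andP[? ?]]]]; split=> //; exists a, b, c.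
move=> [a [b [c [? ?]]]]; split=> //; apply/existsP; exists a.
by apply/existsP; exists b; apply/existsP; exists c; apply/andP.
Qed.

Lemma cplx_is_complex : is_complex cplx.
Proof.
split; first by apply/negP => /cplxP[]; rewrite eqxx.
move=> A B /cplxP[_ [a [b [c [abc Aabc]]]]] BA B0; apply/cplxP; split=> //.
by exists a, b, c; split=> //; exact: fintype.subset_trans Aabc.
Qed.

(** A triangle carrying A can be rotated until [w] comes first; hence the link list of [w] describes
    its whole star. *)
Lemma simplex_at A w : A \in cplx -> w \in A ->
  exists2 k, (k < sz K w)%N & A \subset [set w; lk K w k; lk K w k.+1]%SET.
Proof.
move=> /cplxP[_ [a [b [c [abc sA]]]]] wA.
have H b' c' : tri w b' c' -> A \subset [set w; b'; c']%SET ->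
    exists2 k, (k < sz K w)%N & A \subset [set w; lk K w k; lk K w k.+1]%SET.
  by move=> /triP[k kw [<- <-]] sA'; exists k.
have := fintype.subsetP sA _ wA; rewrite !inE -orbA => /or3P[] /eqP wE; rewrite -wE in abc sA.
- exact: H abc sA.
- apply: (H _ _ (tri_rot abc)); apply: fintype.subset_trans sA _.
  by apply/fintype.subsetP => x; rewrite !inE; case: (x == a); case: (x == w); case: (x == c).
- apply: (H _ _ (tri_rot (tri_rot abc))); apply: fintype.subset_trans sA _.
  by apply/fintype.subsetP => x; rewrite !inE; case: (x == a); case: (x == w); case: (x == b).
Qed.

Lemma simplex_link w k A : (k < sz K w)%N -> A != finset.set0 ->
  A \subset [set w; lk K w k; lk K w k.+1]%SET -> A \in cplx.
Proof.
move=> kw A0 sA; apply/cplxP; split=> //.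
by exists w, (lk K w k), (lk K w k.+1); split=> //; apply/triP; exists k.
Qed.

(** The direction a -> b occurs at one position of the link of [a], which determines the third
    vertex; this is the coherence clause. *)
Lemma cplx_oriented : coherent_orientation cplx tri.
Proof.
split=> [a b c abc|a b c Uabc|a b c d]; last exact: tri_fun.
  split; [exact: tri_uniq abc| |exact: tri_rot|exact: tri_asym].
  apply/cplxP; split; last by exists a, b, c.
  by apply/set0Pn; exists a; rewrite !inE eqxx.
move=> abcK; have [|k ka] := simplex_at abcK (w := a); first by rewrite !inE eqxx.
set b' := lk K a k; set c' := lk K a k.+1 => sub.
have abc' : tri a b' c' by apply/triP; exists k.
have /fintype.subsetP sub' := sub.
have := sub' b; have := sub' c; move: Uabc; rewrite /= !inE !eqxx !orbT.
rewrite negb_or ![b == a]eq_sym ![c == a]eq_sym => /and3P[/andP[/negPf -> /negPf ->]] bc _.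
move=> /(_ isT) /= cE /(_ isT) /= bE.
case/orP: bE bc => /eqP ->; case/orP: cE => /eqP ->; rewrite ?eqxx // => _.
  by rewrite abc'.
by rewrite (tri_rot (tri_rot abc')) orbT.
Qed.

End Complex.

(** * The polyhedron of a complex *)

Lemma support3 (R : realType) (W : finType) (p : W -> R) (a b c : W) :
  uniq [:: a; b; c] -> (forall u, p u != 0 -> u \in [set a; b; c]%SET) ->
  forall u, p u = p a * (u == a)%:R + p b * (u == b)%:R + p c * (u == c)%:R.
Proof.
rewrite /= !inE negb_or => /and3P[/andP[ab ac] bc _] pA u.
have [->|ua] := eqVneq u a.
  by rewrite (negPf ab) (negPf ac) !mulr0 !addr0 mulr1.
have [->|ub] := eqVneq u b.
  by rewrite (negPf bc) !mulr0 add0r addr0 mulr1.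
have [->|uc] := eqVneq u c; first by rewrite !mulr0 !add0r mulr1.
rewrite !mulr0 !addr0; apply/eqP; apply: contraT => pu.
by have := pA u pu; rewrite !inE (negPf ua) (negPf ub) (negPf uc).
Qed.

Lemma sum_eq1 (R : realType) (W : finType) (w : W) : \sum_u (u == w)%:R = 1 :> R.
Proof. by rewrite (bigD1 w) //= eqxx big1 ?addr0 // => u /negPf ->. Qed.

Lemma sum_support3 (R : realType) (W : finType) (p : W -> R) (a b c : W) :
  uniq [:: a; b; c] -> (forall u, p u != 0 -> u \in [set a; b; c]%SET) ->
  \sum_u p u = p a + p b + p c.
Proof.
move=> U pA; under eq_bigr => u _ do rewrite (support3 U pA u).
by rewrite !big_split /= -!mulr_sumr !sum_eq1 !mulr1.
Qed.

Section Polyhedron.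
Variables (R : realType) (W : finType) (K : links W) (w0 : W).
Implicit Types (w u : W) (p : {ptws W -> R}).

Local Notation X := (realization R (cplx K)).
Local Notation M := (set_type X).

Lemma realizationI p (A : {set W}) : A \in cplx K ->
  (forall w, 0 <= p w) -> \sum_w p w = 1 -> (forall w, p w != 0 -> w \in A) ->
  X p.
Proof.
move=> AK p0 p1 pA; split=> //; apply: (cplx_is_complex K).2 AK _ _.
  by apply/fintype.subsetP => w; rewrite inE => /pA.
apply/negP => /eqP supp0; have := oner_neq0 R; rewrite -p1 big1 ?eqxx // => w _.
apply/eqP; apply: contraT => pw.
by have : w \in [set w | p w != 0]%SET; [rewrite inE|rewrite supp0 inE].
Qed.

Lemma realization_le1 p w : X p -> 0 <= p w <= 1.
Proof.
move=> [p0 p1 _]; rewrite p0 -p1 (bigD1 w) //= lerDl.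
by apply: sumr_ge0 => *; exact: p0.
Qed.

Lemma eval_continuous w : continuous (fun p : {ptws W -> R} => p w).
Proof. exact: (@proj_continuous W (fun=> R) w). Qed.

(** Having a prescribed support is not a closed condition. As the complex is closed under taking
    faces, the realization is the finite union, over its simplices A, of the closed sets where the
    coordinates off A vanish. *)
Lemma realization_closed : closed (X : set {ptws W -> R}).
Proof.
have -> : X = \bigcup_(A in [set A : {set W} | A \in cplx K])
    ([set p : {ptws W -> R} | \sum_w p w = 1] `&`
     \bigcap_(w in [set: W]) ([set p | 0 <= p w] `&`
       [set p | w \notin A -> p w = 0])).
  rewrite eqEsubset; split=> [p [p0 p1 pK]|p [A AK [p1 pA]]].
    exists [set w | p w != 0]%SET => //; split=> // w _; split; first exact: p0.
    by rewrite inE negbK => /eqP.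
  apply: (realizationI AK) => // w; first by have [] := pA w I.
  by apply: contraR => wA; apply/eqP; have [_] := pA w I; exact.
apply: closed_bigcup => [|A _]; first exact: finite_finset.
apply: closedI.
  apply: (@closed_comp _ _ (fun p : {ptws W -> R} => \sum_w p w) [set x | x = 1]).
    by move=> p _; apply: continuous_bigsum => w; exact: eval_continuous.
  exact: closed_eq.
apply: closed_bigI => w _; apply: closedI.
  apply: (@closed_comp _ _ (fun p : {ptws W -> R} => p w) [set x | 0 <= x]).
    by move=> p _; exact: eval_continuous.
  exact: closed_ge.
case: (boolP (w \in A)) => wA.
  rewrite (_ : [set p | _] = setT); first exact: closedT.
  by rewrite eqEsubset.
rewrite (_ : [set p | _] = (fun p : {ptws W -> R} => p w) @^-1` [set x | x = 0]).
  apply: closed_comp => [p _|]; first exact: eval_continuous.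
  exact: closed_eq.
by rewrite eqEsubset; split=> p /=; [exact|move=> ->].
Qed.

Lemma ptws_hausdorff : hausdorff_space {ptws W -> R}.
Proof. by apply: hausdorff_product => _; exact: Rhausdorff. Qed.

Lemma realization_compact : compact (X : set {ptws W -> R}).
Proof.
have cI : compact [set p : {ptws W -> R} | forall w, `[0, 1]%classic (p w)].
  by apply: (@tychonoff W (fun=> R) (fun=> `[0, 1]%classic)) => _; exact: segment_compact.
apply: (subclosed_compact realization_closed cI) => p Xp w.
by rewrite /= in_itv /=; exact: realization_le1.
Qed.

Definition vtx w : {ptws W -> R} := fun u => (u == w)%:R.

Lemma vtx_in w : X (vtx w).
Proof.
have w3 : (0 < sz K w)%N by have := sz_gt2 K w; lia.
apply: (@realizationI _ [set w]%SET) => [|u|| u].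
- apply: simplex_link w3 _ _; first by apply/set0Pn; exists w; rewrite inE.
  by rewrite finset.sub1set !inE eqxx.
- exact: ler0n.
- exact: sum_eq1.
- by rewrite /vtx inE; case: (u == w); rewrite //= eqxx.
Qed.

(** A total map onto the subspace, as the notions of homeomorphism and embedding require; points off
    the polyhedron go to the vertex [w0]. *)
Definition toM p : M := insubd (exist _ (vtx w0) (mem_set (vtx_in w0)) : M) p.

Lemma toMK p : X p -> \val (toM p) = p.
Proof. by move=> /mem_set Xp; exact: (@insubdK _ _ M). Qed.

Lemma valM_in (x : M) : X (\val x).
Proof. by case: x => p /= /set_mem. Qed.

Lemma valK_toM (x : M) : toM (\val x) = x.
Proof. by apply: val_inj; rewrite toMK //; exact: valM_in. Qed.

Lemma toM_inj p q : X p -> X q -> toM p = toM q -> p = q.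
Proof. by move=> Xp Xq pq; rewrite -(toMK Xp) pq toMK. Qed.

Lemma val_continuous : continuous (\val : M -> {ptws W -> R}).
Proof. exact: (@initial_continuous M {ptws W -> R} set_val). Qed.

Lemma toM_continuous : {within X, continuous toM}.
Proof.
apply/subspace_sigL_continuousP => x.
rewrite (_ : sigL _ _ = id); first exact: cvg_id.
by apply/funext => y; exact: valK_toM.
Qed.

Lemma toM_comp_continuous (T : topologicalType) (A : set T)
    (f : T -> {ptws W -> R}) :
  (forall x, A x -> X (f x)) -> {within A, continuous f} ->
  {within A, continuous (toM \o f)}.
Proof.
move=> AX /subspace_sigL_continuousP cf; apply/subspace_sigL_continuousP => x.
move=> O [_ [[U oU <-]]] /= Ux UO.
have fX (y : set_type A) : X (f (\val y)) by apply: AX; exact: set_mem (valP y).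
have : nbhs (f (\val x)) U.
  by apply: open_nbhs_nbhs; split=> //; rewrite -(toMK (fX x)); exact: Ux.
move=> /(cf x); rewrite /= !nbhs_simpl /=; apply: filterS => y Uy; apply: UO.
by have : U (\val (toM (f (\val y)))) by rewrite toMK.
Qed.

Lemma polyhedron_hausdorff : hausdorff_space M.
Proof.
rewrite open_hausdorff => x y xy.
have := ptws_hausdorff; rewrite open_hausdorff.
have vxy : \val x != \val y :> {ptws W -> R} by rewrite val_eqE.
move=> /(_ _ _ vxy)[[A B] /= [xA yB] [oA oB /eqP AB]].
exists (\val @^-1` A, \val @^-1` B); split => /=.
- by rewrite inE /=; rewrite inE in xA.
- by rewrite inE /=; rewrite inE in yB.
- by exists A.
- by exists B.
- by rewrite -preimage_setI AB preimage_set0.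
Qed.

Lemma polyhedron_image : [set: M] = toM @` X.
Proof.
rewrite eqEsubset; split=> // x _; exists (\val x); first exact: valM_in.
exact: valK_toM.
Qed.

Lemma polyhedron_compact : compact [set: M].
Proof.
rewrite polyhedron_image; apply: continuous_compact; first exact: toM_continuous.
exact: realization_compact.
Qed.

Lemma polyhedron_orientable : orientable R M.
Proof.
exists W, (cplx K), (tri K); split.
- exact: cplx_is_complex.
- exists toM, \val; split=> [||p Xp|x _].
  + exact: toM_continuous.
  + by apply: continuous_subspaceT; exact: val_continuous.
  + by split=> //; exact: toMK.
  + by split; [exact: valM_in|exact: valK_toM].
- exact: cplx_oriented.
Qed.

Definition star w : set M := [set x | 0 < (\val x : {ptws W -> R}) w].

Lemma star_open w : open (star w).
Proof.
exists [set p : {ptws W -> R} | 0 < p w] => //.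
apply: (@open_comp _ _ (fun p : {ptws W -> R} => p w) [set x | 0 < x]).
  by move=> p _; exact: eval_continuous.
exact: open_gt.
Qed.

(** The closed star of [w] as a cone over its link: [x.1] is the distance from the apex, [x.2] the
    position along the link. *)
Definition star_map w (x : R * R) : {ptws W -> R} :=
  fun u => (1 - x.1) * (u == w)%:R + x.1 * loop (sz K w) (lk K w) x.2 u.

Lemma star_map_continuous w : continuous (star_map w).
Proof.
apply: continuous_into_prod => u x; rewrite /star_map.
apply: cvgD; apply: cvgM.
- by apply: cvgB; [exact: cvg_cst|exact: cvg_fst].
- exact: cvg_cst.
- exact: cvg_fst.
- apply: (@continuous_comp _ _ _ snd (fun s => loop (sz K w) (lk K w) s u)).
    exact: cvg_snd.
  exact: loop_continuous.
Qed.

Lemma star_mapE w r k t u : (k < sz K w)%N -> 0 <= t <= 1 ->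
  star_map w (r, k%:R + t) u = (1 - r) * (u == w)%:R
    + r * ((1 - t) * (u == lk K w k)%:R + t * (u == lk K w k.+1)%:R).
Proof. by move=> kw t01; rewrite /star_map /= loopE. Qed.

Lemma sz_gt0 w : (0 < sz K w)%N.
Proof. by have := sz_gt2 K w; lia. Qed.

Lemma star_map_in w x : rect (sz K w) x -> X (star_map w x).
Proof.
case: x => r s /rectP[/= /andP[r0 r1] s0m].
have [k [t [kw t01 ->]]] := nat_frac (sz_gt0 w) s0m.
have /andP[t0 t1] := t01.
apply: (@realizationI _ [set w; lk K w k; lk K w k.+1]%SET) => [|u||u].
- apply: simplex_link kw _ _ => //; apply/set0Pn; exists w.
  by rewrite !inE eqxx.
- rewrite star_mapE // addr_ge0 ?mulr_ge0 ?ler0n ?subr_ge0 //.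
  by rewrite addr_ge0 ?mulr_ge0 ?ler0n ?subr_ge0.
- under eq_bigr do rewrite star_mapE //.
  rewrite big_split /= -!mulr_sumr big_split /= -!mulr_sumr !sum_eq1; lra.
- rewrite star_mapE // !inE; case: (u == w) => //; case: (u == lk K w k) => //.
  by case: (u == lk K w k.+1); rewrite // !mulr0 addr0 mulr0 addr0 eqxx.
Qed.

(** No vertex lies on its own link, so the coordinate at [w] recovers the radius; radius less than 1
    then characterizes the open star. *)
Lemma star_map_center w x : rect (sz K w) x -> star_map w x w = 1 - x.1.
Proof.
case: x => r s /rectP[/= _ s0m].
have [k [t [kw t01 ->]]] := nat_frac (sz_gt0 w) s0m.
rewrite star_mapE // eqxx eq_sym (negPf (lk_neq kw)).
suff -> : (w == lk K w k.+1) = false by rewrite !mulr0 addr0 mulr0 addr0 mulr1.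
have [kE|kn] := eqVneq k.+1 (sz K w).
  by rewrite kE lk_closed eq_sym (negPf (lk_neq (sz_gt0 w))).
by rewrite eq_sym (negPf (lk_neq _)) //; lia.
Qed.

Lemma star_mapP w x y : rect (sz K w) x -> rect (sz K w) y ->
  star_map w x = star_map w y <-> same_polar (sz K w) x y.
Proof.
move=> rx ry; have /rectP[_ x2] := rx; have /rectP[_ y2] := ry.
split=> [xy|[x1 h]].
  have x1 : x.1 = y.1.
    have := star_map_center rx; rewrite xy star_map_center //; lra.
  split=> //; have [x10|x10] := eqVneq x.1 0; first by constructor 1.
  have : loop (sz K w) (lk K w) x.2 =1 loop (sz K w) (lk K w) y.2.
    move=> u; have := congr1 (@^~ u) xy; rewrite /star_map /= x1 => /addrI.
    by apply: mulfI; rewrite -x1.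
  move=> /(loop_inj (sz_gt2 K w) (lk_closed K w) (@lk_inj _ K w) x2 y2).
  by case=> h; [constructor 2|constructor 3|constructor 4].
apply/funext => u; rewrite /star_map -x1.
have lc := @loop_closed R _ _ _ (sz_gt2 K w) (lk_closed K w).
by case: h => [->|->|[-> ->]|[-> ->]]; rewrite ?mul0r // lc.
Qed.

Lemma star_image w : (toM \o star_map w) @` (rect (sz K w) `&` [set x | x.1 < 1])
  = star w.
Proof.
rewrite eqEsubset; split=> [_ [x [rx /= x1] <-]|x /= sx].
  by rewrite /star /= toMK ?star_map_center ?subr_gt0 //; exact: star_map_in.
have [p0 p1 pK] := valM_in x; set p := \val x in p0 p1 pK.
have [|k kw] := simplex_at pK (w := w); first by rewrite inE gt_eqF.
set b := lk K w k; set c := lk K w k.+1 => /fintype.subsetP sub.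
have wbc : uniq [:: w; b; c] by apply: (@tri_uniq _ K); apply/triP; exists k.
have supp u : p u != 0 -> u \in [set w; b; c]%SET.
  by move=> pu; apply: sub; rewrite inE.
have pE := support3 wbc supp.
have pwbc : p w + p b + p c = 1 by rewrite -p1 (sum_support3 wbc supp).
have pw0 : 0 < p w by [].
have pb0 := p0 b; have pc0 := p0 c.
have kr : k%:R + 1 <= (sz K w)%:R :> R by rewrite natr1 ler_nat.
have k0 : 0 <= k%:R :> R by rewrite ler0n.
(* The radius is p b + p c, and [t] is the share of [c] in it; at the apex this share is
   undetermined and is taken to be 0. *)
suff [t t01 [tb tc]] : exists2 t, 0 <= t <= 1 &
    (p b + p c) * (1 - t) = p b /\ (p b + p c) * t = p c.
  exists (p b + p c, k%:R + t).
    by split=> /=; [apply/rectP => /=; split; lra|lra].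
  rewrite -[RHS]valK_toM /=; congr toM; apply/funext => u.
  rewrite star_mapE // mulrDr !mulrA tb tc -/p [RHS]pE -/b -/c.
  have -> : 1 - (p b + p c) = p w by lra.
  by rewrite addrA.
have [pbc|pbc] := eqVneq (p b + p c) 0; first by exists 0; lra.
exists (p c / (p b + p c)); last by split; field.
by rewrite divr_ge0 ?addr_ge0 //= ler_pdivrMr; lra.
Qed.

Lemma star_disc w : homeomorphic (star w) (@open_disc R).
Proof.
have m0 := sz_gt0 w.
rewrite -star_image -(polar_image_open R m0).
have AC : rect (sz K w) `&` [set x | x.1 < 1] `<=` @rect R (sz K w) by move=> x [].
have P_inj x y : rect (sz K w) x -> rect (sz K w) y ->
    (toM \o star_map w) x = (toM \o star_map w) y <-> same_polar (sz K w) x y.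
  move=> rx ry; rewrite -star_mapP //; split=> [/toM_inj|/= -> //].
  by apply; exact: star_map_in.
apply: (@homeomorphic_images _ _ _ (rect (sz K w))) => //.
- exact: polyhedron_hausdorff.
- exact: rect_compact.
- apply: toM_comp_continuous; first exact: star_map_in.
  by apply: continuous_subspaceT; exact: star_map_continuous.
- by apply: continuous_subspaceT; exact: polar_continuous.
- exists (0, 0); split=> /=; last exact: ltr01.
  by apply/rectP; rewrite /= lexx ler01 ler0n.
- move=> x y rx [ry /= y1] /P_inj -/(_ rx ry) [x1 _].
  by split=> //=; rewrite x1.
- move=> x y rx [ry /= y1] /(polarE m0 rx ry) [x1 _].
  by split=> //=; rewrite x1.
- by move=> x y [rx _] [ry _]; rewrite P_inj // polarE.
Qed.

(** The open stars cover the polyhedron, because every point has a positive barycentric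
    coordinate. *)
Lemma polyhedron_surface : connected [set: M] -> is_surface R M.
Proof.
move=> cM; split=> //.
- by exists (toM (vtx w0)).
- exact: polyhedron_hausdorff.
- exact: polyhedron_compact.
move=> x; have [p0 p1 pK] := valM_in x.
have [w pw] : exists w, 0 < (\val x : {ptws W -> R}) w.
  have : [set w | (\val x : {ptws W -> R}) w != 0]%SET != finset.set0.
    by apply: contraNneq (cplx_is_complex K).1 => <-.
  by move=> /set0Pn[w]; rewrite inE => pw; exists w; rewrite lt_def pw p0.
exists (star w); split; [exact: star_open|by []|exact: star_disc].
Qed.

End Polyhedron.

(** * Triangulating a map with one face of each colour *)

(* Edges are directed so that the face [true] lies on their left and the face
   [false] on their right; [step c] is the successor along the boundary of the
   face [c]. [inn v] lists the edges with head [v] in their cyclic order around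
   [v]. *)
Record edge_map (V : finType) := EdgeMap {
  edge :> finType;
  tl : edge -> V;
  hd : edge -> V;
  edge_inj : forall e e', tl e = tl e' -> hd e = hd e' -> e = e';
  edge_antisym : forall e e', tl e = hd e' -> hd e = tl e' -> False;
  step : bool -> edge -> edge;
  pstep : bool -> edge -> edge;
  stepK : forall c, cancel (step c) (pstep c);
  pstepK : forall c, cancel (pstep c) (step c);
  tl_step : forall c e, tl (step c e) = hd e;
  len : nat;
  len_gt2 : (2 < len)%N;
  walk : bool -> nat -> edge;
  walk_closed : forall c, walk c len = walk c 0;
  walk_inj : forall c i j, (i < len)%N -> (j < len)%N ->
    walk c i = walk c j -> i = j;
  walk_surj : forall c e, exists2 k, (k < len)%N & walk c k = e;
  walkS : forall c k, walk c k.+1 = step c (walk c k);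
  deg : nat;
  inn : V -> nat -> edge;
  deg_gt0 : (0 < deg)%N;
  inn_closed : forall v, inn v deg = inn v 0;
  inn_inj : forall v i j, (i < deg)%N -> (j < deg)%N ->
    inn v i = inn v j -> i = j;
  inn_surj : forall e, exists2 k, (k < deg)%N & inn (hd e) k = e;
  hd_inn : forall v k, hd (inn v k) = v;
  inn_rot : forall v k, step true (inn v k.+1) = step false (inn v k) }.

Section MapLinks.
Variables (V : finType) (D : edge_map V).
Implicit Types (v : V) (e : D) (c : bool).

(* The vertices of the triangulation: those of the graph, one for each side of
   an edge, and the centres of the two faces. *)
Definition mapW : finType := ((V + bool * D) + bool)%type.

Definition vv v : mapW := inl (inl v).
Definition rr c e : mapW := inl (inr (c, e)).
Definition ff c : mapW := inr c.

(** Six entries per incoming edge [e]: its tail, the corner of the face [false] between [e] and its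
    successor [e1], the head of [e1], and the corner of the face [true] between [e1] and the next
    incoming edge. By [inn_rot] that edge is indeed the predecessor of [e1] in the face [true]. *)
Definition link_v v k : mapW :=
  let e := inn D v (k %/ 6) in let e1 := step false e in
  nth (vv v) [:: vv (tl e); rr false e; rr false e1; vv (hd e1); rr true e1;
    rr true (inn D v (k %/ 6).+1)] (k %% 6).

(** A pentagon, with its first entry repeated at the end. The two colours are listed in opposite
    senses because the faces lie on opposite sides of the edge. *)
Definition link_r c e : seq mapW :=
  if c then [:: vv (tl e); vv (hd e); rr c (step c e); ff c; rr c (pstep c e);
    vv (tl e)]
  else [:: vv (tl e); rr c (pstep c e); ff c; rr c (step c e); vv (hd e);
    vv (tl e)].

Definition link_f c k : mapW := rr c (walk D c (if c then k else len D - k)%N).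

Definition map_sz (w : mapW) : nat :=
  match w with inl (inl _) => deg D * 6 | inl (inr _) => 5 | inr _ => len D end.

Definition map_lk (w : mapW) (k : nat) : mapW :=
  match w with
  | inl (inl v) => link_v v k
  | inl (inr (c, e)) => nth w (link_r c e) k
  | inr c => link_f c k
  end.

Lemma hd_pstep c e : hd (pstep c e) = tl e.
Proof. by rewrite -(tl_step c) pstepK. Qed.

Lemma tl_neq_hd e : tl e <> hd e.
Proof. by move=> h; exact: (edge_antisym h (esym h)). Qed.

Lemma step_inj c : injective (@step _ D c).
Proof. exact: can_inj (stepK c). Qed.

Lemma inn_predecessor e : exists2 k, (k < deg D)%N & inn D (hd e) k.+1 = e.
Proof.
have [[|k] kd <-] := inn_surj e; rewrite hd_inn; last by exists k => //; lia.
by exists (deg D).-1; rewrite prednK ?deg_gt0 ?inn_closed.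
Qed.

Lemma inn_out c e : exists2 k, (k < deg D)%N & step c (inn D (tl e) k) = e.
Proof.
have [k kd kE] := inn_surj (pstep c e); exists k => //.
by rewrite hd_pstep in kE; rewrite kE pstepK.
Qed.

Lemma link_vE v i j : (j < 6)%N -> link_v v (i * 6 + j) =
  let e := inn D v i in let e1 := step false e in
  nth (vv v) [:: vv (tl e); rr false e; rr false e1; vv (hd e1); rr true e1;
    rr true (inn D v i.+1)] j.
Proof. by move=> j6; rewrite /link_v divnMDl // divn_small // addn0 modnMDl modn_small. Qed.

Lemma link_vP k : (k < deg D * 6)%N ->
  exists i j, [/\ (i < deg D)%N, (j < 6)%N & k = (i * 6 + j)%N].
Proof.
move=> kd; exists (k %/ 6)%N, (k %% 6)%N; split.
- by rewrite ltn_divLR.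
- by rewrite ltn_mod.
- exact: divn_eq.
Qed.

Lemma inn_injS v i j : (i < deg D)%N -> (j < deg D)%N ->
  inn D v i.+1 = inn D v j.+1 -> i = j.
Proof.
move=> id jd; have [ie|ine] := eqVneq i.+1 (deg D); have [je|jne] := eqVneq j.+1 (deg D).
- by lia.
- by rewrite ie inn_closed => /inn_inj; have := deg_gt0 D; lia.
- by rewrite je inn_closed => /inn_inj; have := deg_gt0 D; lia.
- by move=> /inn_inj; lia.
Qed.

Lemma step_neq c e : step c e <> e.
Proof.
by move=> h; apply: (@tl_neq_hd e); rewrite -{1}h tl_step.
Qed.

(** Equality would make the boundary walk 2-periodic, against [len_gt2]. This keeps the two ring
    vertices in the link of [rr c e] apart. *)
Lemma step_neq_pstep c e : step c e <> pstep c e.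
Proof.
move=> h; have [k kl kE] := walk_surj c (pstep c e).
have ke : walk D c k.+1 = e by rewrite walkS kE pstepK.
have ke2 : walk D c k.+2 = walk D c k by rewrite walkS ke kE.
have L2 := len_gt2 D.
have [kl2|kl2] := ltnP k.+2 (len D); first by have := walk_inj kl2 kl ke2; lia.
have [kl1|kl1] := eqVneq k.+2 (len D).
  by move: ke2; rewrite kl1 walk_closed => /walk_inj; lia.
have kE' : k = (len D).-1 by lia.
have : walk D c 1 = walk D c k.
  rewrite -ke2 walkS [in RHS]walkS; congr step.
  by rewrite -(walk_closed D c); congr walk; lia.
by move=> /walk_inj; lia.
Qed.

(** Here the simplicity of the graph enters: the edges at [v] lead to distinct neighbours by
    [edge_inj], no neighbour is both a tail and a head by [edge_antisym], and no edge both enters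
    and leaves [v]. *)
Lemma link_v_inj v i j : (i < deg D * 6)%N -> (j < deg D * 6)%N ->
  link_v v i = link_v v j -> i = j.
Proof.
move=> /link_vP[k [a [kd a6 ->]]] /link_vP[l [b [ld b6 ->]]].
rewrite !link_vE //=.
have h0 : tl (inn D v k) = tl (inn D v l) -> k = l.
  by move=> h; apply: (inn_inj kd ld); apply: edge_inj h _; rewrite !hd_inn.
have h3 : hd (step false (inn D v k)) = hd (step false (inn D v l)) -> k = l.
  move=> h; apply: (inn_inj kd ld); apply: (@step_inj false); apply: edge_inj h.
  by rewrite !tl_step !hd_inn.
have h03 x y : tl (inn D v x) <> hd (step false (inn D v y)).
  by move=> h; apply: (edge_antisym h); rewrite tl_step !hd_inn.
have h12 x y : inn D v x <> step false (inn D v y).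
  by move=> h; apply: (@tl_neq_hd (inn D v x)); rewrite {1}h tl_step !hd_inn.
have h2 : step false (inn D v k) = step false (inn D v l) -> k = l.
  by move=> /step_inj; exact: inn_inj.
case: a a6 => [|[|[|[|[|[|a]]]]]] //= _; case: b b6 => [|[|[|[|[|[|b]]]]]] //= _; case.
- by move=> /h0 ->.
- by move=> /h03.
- by move=> /(inn_inj kd ld) ->.
- by move=> /h12.
- by move=> /esym/h12.
- by move=> /h2 ->.
- by move=> /esym/h03.
- by move=> /h3 ->.
- by move=> /h2 ->.
- by move=> /esym/h12.
- by move=> /h12.
- by move=> /(inn_injS kd ld) ->.
Qed.

Lemma link_v_neq v i : (i < deg D * 6)%N -> link_v v i != vv v.
Proof.
move=> /link_vP[k [a [kd a6 ->]]]; rewrite link_vE //=; apply/eqP.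
case: a a6 => [|[|[|[|[|[|a]]]]]] //= _ [].
  by move=> h; apply: (@tl_neq_hd (inn D v k)); rewrite hd_inn.
by move=> h; apply: (@tl_neq_hd (step false (inn D v k))); rewrite tl_step hd_inn.
Qed.

Lemma link_r_inj c e i j : (i < 5)%N -> (j < 5)%N ->
  nth (rr c e) (link_r c e) i = nth (rr c e) (link_r c e) j -> i = j.
Proof.
have := @tl_neq_hd e; have := @step_neq_pstep c e.
rewrite /link_r; case: c => sp th;
by case: i => [|[|[|[|[|i]]]]] //= _; case: j => [|[|[|[|[|j]]]]] //= _ [] // h;
  first [exact: (False_ind _ (sp h))|exact: (False_ind _ (sp (esym h)))
        |exact: (False_ind _ (th h))|exact: (False_ind _ (th (esym h)))].
Qed.

Lemma link_r_neq c e i : (i < 5)%N -> nth (rr c e) (link_r c e) i != rr c e.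
Proof.
have := @step_neq c e; have pn : pstep c e <> e.
  by move=> h; apply: (@step_neq c e); rewrite -{1}h pstepK.
rewrite /link_r; case: c pn => pn sn;
by case: i => [|[|[|[|[|i]]]]] //= _; apply/eqP => -[].
Qed.

Lemma link_f_inj c i j : (i < len D)%N -> (j < len D)%N ->
  link_f c i = link_f c j -> i = j.
Proof.
move=> il jl; case: c => -[]; first exact: walk_inj.
case: i il => [|i] il; case: j jl => [|j] jl //=; rewrite ?subn0 ?walk_closed => /walk_inj; lia.
Qed.

Lemma map_rot w i : (i < map_sz w)%N ->
  exists2 j, (j < map_sz (map_lk w i))%N &
    map_lk (map_lk w i) j = map_lk w i.+1 /\ map_lk (map_lk w i) j.+1 = w.
Proof.
have atv k j : (k < deg D)%N -> (j < 6)%N -> (k * 6 + j < deg D * 6)%N by lia.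
case: w => [[v|[c e]]|c] /=.
- move=> /link_vP[k [a [kd a6 ->]]].
  have nextv : link_v v (k.+1 * 6) = vv (tl (inn D v k.+1)).
    by rewrite -[(k.+1 * 6)%N]addn0 link_vE.
  have -> : link_v v (k * 6 + a).+1 = if a == 5 then link_v v (k.+1 * 6)
      else link_v v (k * 6 + a.+1).
    by case: eqP => [->|_]; congr link_v; lia.
  rewrite nextv link_vE //; set e := inn D v k; set e1 := step false e.
  case: a a6 => [|[|[|[|[|[|a]]]]]] //= _; rewrite ?link_vE //=.
  (* Seen from its tail, [e] is an outgoing edge, namely the [e1] of some incoming edge there, so
     the triangle begins at slot 2. *)
  + have [l ld lE] := inn_out false e; exists (l * 6 + 2)%N; first exact: atv.
    by rewrite -addnS !link_vE //= lE; split=> //; rewrite hd_inn.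
  + by exists 3 => //=; rewrite hd_inn.
  + by exists 4 => //=; rewrite tl_step hd_inn.
  + have [l ld lE] := inn_predecessor e1; exists (l * 6 + 5)%N; first exact: atv.
    rewrite link_vE //= lE; split=> //.
    have -> : (l * 6 + 5).+1 = (l.+1 * 6 + 0)%N by lia.
    by rewrite link_vE //= lE tl_step hd_inn.
  + exists 4 => //=; split; last by rewrite tl_step hd_inn.
    by rewrite /e1 -inn_rot stepK.
  + by exists 0%N => //=; rewrite hd_inn.
- case: c => /=.
  + case: i => [|[|[|[|[|i]]]]] //= _.
    * have [l ld lE] := inn_out false e; exists (l * 6 + 3)%N; first exact: atv.
      by rewrite -addnS !link_vE //= lE.
    * have [l ld lE] := inn_predecessor e; exists (l * 6 + 4)%N; first exact: atv.
      by rewrite -addnS !link_vE //= -inn_rot lE.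
    * by exists 3 => //=; rewrite stepK.
    * have [l ld lE] := walk_surj true (pstep true e); exists l => //=.
      by rewrite /link_f walkS lE pstepK.
    * by exists 1%N => //=; rewrite hd_pstep pstepK.
  + case: i => [|[|[|[|[|i]]]]] //= _.
    * have [l ld lE] := inn_out false e; exists (l * 6 + 1)%N; first exact: atv.
      rewrite -addnS !link_vE //= lE; split=> //.
      by rewrite -[in RHS]lE stepK.
    * by exists 2 => //=; rewrite pstepK.
    (* The link of the centre [ff false] runs against the walk, so the pair formed by the successor
       of [e] and [e] starts at the reflected index. *)
    * have [l ld lE] := walk_surj false e; exists (len D - l.+1)%N; first lia.
      rewrite /link_f; split.
        by rewrite (_ : _ - _ = l.+1)%N ?walkS ?lE //; lia.
      by rewrite (_ : _ - _ = l)%N ?lE //; lia.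
    * by exists 0%N => //=; rewrite tl_step stepK.
    * have [l ld lE] := inn_surj e; exists (l * 6)%N; first by lia.
      have -> : (l * 6).+1 = (l * 6 + 1)%N by lia.
      by rewrite -{1}[(l * 6)%N]addn0 !link_vE //= lE.
- case: c => /= il; rewrite /link_f.
  + by exists 2 => //=; rewrite walkS.
  + exists 1%N => //=; split=> //; congr (rr false _).
    have -> : (len D - i = (len D - i.+1).+1)%N by lia.
    by rewrite walkS stepK.
Qed.

Definition map_links : links mapW.
Proof.
apply: (@Links mapW map_sz map_lk).
- by move=> [[v|[c e]]|c] //=; [have := deg_gt0 D; lia|exact: len_gt2].
- move=> [[v|[c e]]|c] /=.
  + by rewrite -[X in link_v v X]addn0 -[RHS]/(link_v v (0 * 6 + 0)) !link_vE // inn_closed.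
  + by case: c.
  + by case: c; rewrite /link_f ?subn0 ?subnn walk_closed.
- move=> [[v|[c e]]|c] i j /=.
  + exact: link_v_inj.
  + exact: link_r_inj.
  + exact: link_f_inj.
- move=> [[v|[c e]]|c] i //=.
  + exact: link_v_neq.
  + exact: link_r_neq.
- exact: map_rot.
Defined.

(** The triangles on the side [c] of [e]: [tri1] stands on the edge itself, [tri2] on the ring edge
    from [e] to its successor with apex at the head of [e], and [tri3] joins that ring edge to the
    centre. *)
Definition tri1 c e : {set mapW} := [set rr c e; vv (tl e); vv (hd e)]%SET.
Definition tri2 c e : {set mapW} := [set rr c e; vv (hd e); rr c (step c e)]%SET.
Definition tri3 c e : {set mapW} := [set rr c e; rr c (step c e); ff c]%SET.

End MapLinks.

Ltac no_minmax a :=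
  lazymatch a with
  | context [Order.max _ _] => fail
  | context [Order.min _ _] => fail
  | _ => idtac
  end.

Ltac minmax := repeat match goal with
  | |- context [Order.max ?a ?b] => no_minmax a; no_minmax b; case: (leP a b) => ?
  | |- context [Order.min ?a ?b] => no_minmax a; no_minmax b; case: (leP a b) => ?
  end; try lra.

Section MapComplex.
Variables (V : finType) (D : edge_map V).
Local Notation K := (map_links D).

Lemma subset3 (W : finType) (a b c : W) (B : {set W}) :
  a \in B -> b \in B -> c \in B -> [set a; b; c]%SET \subset B.
Proof. by move=> aB bB cB; rewrite !finset.subUset !finset.sub1set aB bB cB. Qed.

(** Lists the simplices by sides of edges instead of by links, which is how the parametrizations of
    the two faces cover them. *)
Lemma map_simplexP (A : {set mapW D}) : A \in cplx K ->
  exists c (e : D), [\/ A \subset tri1 c e, A \subset tri2 c e | A \subset tri3 c e].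
Proof.
move=> /cplxP[_ [a [b [c [/triP[k ka [<- <-]] sA]]]]].
suff [c' [e sub]] : exists c (e : D),
    [\/ [set a; lk K a k; lk K a k.+1]%SET \subset tri1 c e,
        [set a; lk K a k; lk K a k.+1]%SET \subset tri2 c e
      | [set a; lk K a k; lk K a k.+1]%SET \subset tri3 c e].
  exists c', e; case: sub => sub.
  - by constructor 1; exact: fintype.subset_trans sub.
  - by constructor 2; exact: fintype.subset_trans sub.
  - by constructor 3; exact: fintype.subset_trans sub.
case: a ka {sA} => [[v|[c' e]]|c'] /= ka.
- have [i [j [id j6 kE]]] := link_vP ka; rewrite kE.
  have nextv : link_v D v (i.+1 * 6) = vv D (tl (inn D v i.+1)).
    by rewrite -[(i.+1 * 6)%N]addn0 link_vE.
  have -> : link_v D v (i * 6 + j).+1 = if j == 5 then link_v D v (i.+1 * 6)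
      else link_v D v (i * 6 + j.+1).
    by case: eqP => [->|_]; congr link_v; lia.
  rewrite nextv link_vE //; set e := inn D v i; set e1 := step false e.
  have ve : v = hd e by rewrite hd_inn.
  have ve1 : v = tl e1 by rewrite tl_step.
  have e12 : step true (inn D v i.+1) = e1 by rewrite inn_rot.
  have ve2 : v = hd (inn D v i.+1) by rewrite hd_inn.
  case: j j6 kE => [|[|[|[|[|[|j]]]]]] //= _ _; rewrite ?link_vE //=.
  + by exists false, e; constructor 1; apply: subset3; rewrite !inE -ve ?eqxx ?orbT.
  + by exists false, e; constructor 2; apply: subset3; rewrite !inE -ve ?eqxx ?orbT.
  + by exists false, e1; constructor 1; apply: subset3; rewrite !inE -ve1 ?eqxx ?orbT.
  + by exists true, e1; constructor 1; apply: subset3; rewrite !inE -ve1 ?eqxx ?orbT.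
  + exists true, (inn D v i.+1); constructor 2.
    by apply: subset3; rewrite !inE e12 -ve2 ?eqxx ?orbT.
  + exists true, (inn D v i.+1); constructor 1.
    by apply: subset3; rewrite !inE -ve2 ?eqxx ?orbT.
- case: c' ka => ka; case: k ka => [|[|[|[|[|k]]]]] //= _.
  + by exists true, e; constructor 1; apply: subset3; rewrite !inE ?eqxx ?orbT.
  + by exists true, e; constructor 2; apply: subset3; rewrite !inE ?eqxx ?orbT.
  + by exists true, e; constructor 3; apply: subset3; rewrite !inE ?eqxx ?orbT.
  + exists true, (pstep true e); constructor 3.
    by apply: subset3; rewrite !inE pstepK ?eqxx ?orbT.
  + exists true, (pstep true e); constructor 2.
    by apply: subset3; rewrite !inE pstepK hd_pstep ?eqxx ?orbT.
  + exists false, (pstep false e); constructor 2.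
    by apply: subset3; rewrite !inE pstepK hd_pstep ?eqxx ?orbT.
  + exists false, (pstep false e); constructor 3.
    by apply: subset3; rewrite !inE pstepK ?eqxx ?orbT.
  + by exists false, e; constructor 3; apply: subset3; rewrite !inE ?eqxx ?orbT.
  + by exists false, e; constructor 2; apply: subset3; rewrite !inE ?eqxx ?orbT.
  + by exists false, e; constructor 1; apply: subset3; rewrite !inE ?eqxx ?orbT.
- rewrite /link_f; case: c' ka => /= ka.
  + exists true, (walk D true k); constructor 3.
    by apply: subset3; rewrite !inE ?walkS ?eqxx ?orbT.
  + exists false, (walk D false (len D - k.+1)); constructor 3.
    have -> : (len D - k = (len D - k.+1).+1)%N by lia.
    by apply: subset3; rewrite !inE ?walkS ?eqxx ?orbT.
Qed.

Lemma tri_cplx (A : {set mapW D}) c (e : D) : A != finset.set0 ->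
  [\/ A \subset tri1 c e, A \subset tri2 c e | A \subset tri3 c e] ->
  A \in cplx K.
Proof.
move=> A0 H; have P k : (k < 5)%N -> A \subset [set rr c e;
    nth (rr c e) (link_r c e) k; nth (rr c e) (link_r c e) k.+1]%SET ->
    A \in cplx K.
  by move=> k5; apply: (@simplex_link _ K (rr c e)).
have S a b d : A \subset [set a; b; d]%SET -> A \subset [set a; d; b]%SET.
  move=> sA; apply: fintype.subset_trans sA _.
  by apply: subset3; rewrite !inE eqxx ?orbT.
(* All three triangles occur in the link of [rr c e]: at positions 0, 1, 2 for [true] and, with two
   vertices exchanged, at 4, 3, 2 for [false]. *)
by case: c {S} P H (S) => P [] H S; [exact: (P 0%N)|exact: (P 1%N)|exact: (P 2%N)
  |exact: (P 4%N _ (S _ _ _ H))|exact: (P 3%N _ (S _ _ _ H))|exact: (P 2%N _ (S _ _ _ H))].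
Qed.

Lemma tri1_uniq c (e : D) : uniq [:: rr c e; vv D (tl e); vv D (hd e)].
Proof. by rewrite /= !inE /= andbT; apply/eqP => -[]; exact: tl_neq_hd. Qed.

Lemma tri2_uniq c (e : D) : uniq [:: rr c e; vv D (hd e); rr c (step c e)].
Proof.
by rewrite /= !inE /= andbT; apply/eqP => -[] /esym; exact: step_neq.
Qed.

Lemma tri3_uniq c (e : D) : uniq [:: rr c e; rr c (step c e); ff D c].
Proof.
by rewrite /= !inE /= orbF andbT; apply/eqP => -[] /esym; exact: step_neq.
Qed.

End MapComplex.

(** * Parametrization of a closed face *)

Section Hats.
Variable R : realType.

(** Barycentric weight of a vertex on the outer circle of the annulus, at angular offset z from it
    and total inner weight y; [inner_hat] is the counterpart for the ring. The asymmetry in z comes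
    from the diagonals, which join the inner vertex k to the outer vertex k + 1. *)
Definition outer_hat (y z : R) : R :=
  Num.max 0 (Num.min (1 + z) (Num.min (1 - y) (1 - y - z))).

Definition inner_hat (y z : R) : R :=
  Num.max 0 (Num.min y (Num.min (1 - z) (z + y))).

Lemma outer_hat0 (y z : R) : 0 <= y -> 1 <= `|z| -> outer_hat y z = 0.
Proof.
move=> y0; rewrite /outer_hat; case: (lerP 0 z) => z0; first by rewrite ger0_norm // => z1; minmax.
by rewrite ltr0_norm // => z1; minmax.
Qed.

Lemma inner_hat0 (y z : R) : y <= 1 -> 1 <= `|z| -> inner_hat y z = 0.
Proof.
move=> y1; rewrite /inner_hat; case: (lerP 0 z) => z0; first by rewrite ger0_norm // => z1; minmax.
by rewrite ltr0_norm // => z1; minmax.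
Qed.

Lemma hatsE (y t : R) : 0 <= y -> y <= 1 -> 0 <= t -> t <= 1 ->
  [/\ inner_hat y t = Num.min y (1 - t),
      inner_hat y (t - 1) = Num.max 0 (t + y - 1),
      outer_hat y t = Num.max 0 (1 - y - t)
    & outer_hat y (t - 1) = Num.min t (1 - y)].
Proof. by move=> y0 y1 t0 t1; rewrite /inner_hat /outer_hat; split; minmax. Qed.

End Hats.

Section FaceMap.
Variables (R : realType) (V : finType) (D : edge_map V) (c : bool).
Implicit Types (x : R * R) (u : mapW D) (k : nat) (e : D).
Local Notation K := (map_links D).
Local Notation X := (realization R (cplx K)).

(* The annulus [1/2 <= r <= 1] is cut into triangles alternately based on its
   two boundary circles; [y] is the barycentric weight of the inner one. *)
Definition face_map x : {ptws mapW D -> R} := fun u =>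
  let y := Num.min 1 (2 - 2 * x.1) in
  Num.max 0 (1 - 2 * x.1) * (u == ff D c)%:R
  + Num.min 1 (2 * x.1) *
      (\sum_(j < (len D).+1) inner_hat y (x.2 - j%:R) * (u == rr c (walk D c j))%:R)
  + \sum_(j < (len D).+1) outer_hat y (x.2 - j%:R) * (u == vv D (tl (walk D c j)))%:R.

Lemma face_mapE (r t : R) k u : 0 <= r <= 1 -> (k < len D)%N -> 0 <= t <= 1 ->
  let y := Num.min 1 (2 - 2 * r) in
  face_map (r, k%:R + t) u = Num.max 0 (1 - 2 * r) * (u == ff D c)%:R
  + Num.min 1 (2 * r) * (Num.min y (1 - t) * (u == rr c (walk D c k))%:R
      + Num.max 0 (t + y - 1) * (u == rr c (walk D c k.+1))%:R)
  + (Num.max 0 (1 - y - t) * (u == vv D (tl (walk D c k)))%:R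
      + Num.min t (1 - y) * (u == vv D (hd (walk D c k)))%:R).
Proof.
move=> /andP[r0 r1] kL t01 y; have /andP[t0 t1] := t01.
have y0 : 0 <= y by rewrite le_min ler01 /=; clear -r1; lra.
have y1 : y <= 1 by rewrite ge_min lexx.
have [E1 E2 E3 E4] := hatsE y0 y1 t0 t1.
rewrite /face_map /= -/y.
rewrite (sum_window (F := inner_hat y) (fun j => (u == rr c (walk D c j))%:R)) //;
  last by move=> z; exact: inner_hat0.
rewrite (sum_window (F := outer_hat y) (fun j => (u == vv D (tl (walk D c j)))%:R)) //;
  last by move=> z; exact: outer_hat0.
by rewrite -(tl_step c (walk D c k)) -walkS E1 E2 E3 E4.
Qed.

End FaceMap.

Lemma max_continuous2 (R : realType) (T : topologicalType) (f g : T -> R) :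
  continuous f -> continuous g -> continuous (fun x => Num.max (f x) (g x)).
Proof. by move=> cf cg x; exact: (@continuous_max R T f g x (cf x) (cg x)). Qed.

Lemma min_continuous2 (R : realType) (T : topologicalType) (f g : T -> R) :
  continuous f -> continuous g -> continuous (fun x => Num.min (f x) (g x)).
Proof. by move=> cf cg x; exact: (@continuous_min R T f g x (cf x) (cg x)). Qed.

Section FaceMapFormulas.
Variables (R : realType) (V : finType) (D : edge_map V).
Implicit Types (c : bool) (x : R * R) (u : mapW D) (k : nat) (e : D) (r t : R).
Local Notation K := (map_links D).
Local Notation X := (realization R (cplx K)).
Local Notation face_map := (@face_map R V D).

Lemma face_map_continuous c : continuous (face_map c).
Proof.
have ccst (a : R) : continuous (fun _ : R * R => a) by move=> x; exact: cvg_cst.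
have cf : continuous (@fst R R) by move=> x; exact: cvg_fst.
have cs : continuous (@snd R R) by move=> x; exact: cvg_snd.
have cD (f g : R * R -> R) : continuous f -> continuous g ->
    continuous (fun x => f x + g x) by move=> hf hg x; apply: cvgD; [exact: hf|exact: hg].
have cB (f g : R * R -> R) : continuous f -> continuous g ->
    continuous (fun x => f x - g x) by move=> hf hg x; apply: cvgB; [exact: hf|exact: hg].
have cM (f g : R * R -> R) : continuous f -> continuous g ->
    continuous (fun x => f x * g x) by move=> hf hg x; apply: cvgM; [exact: hf|exact: hg].
have cy : continuous (fun x : R * R => Num.min 1 (2 - 2 * x.1)).
  by apply: min_continuous2 => //; apply: (cB _ _) => //; apply: (cM _ _).
apply: continuous_into_prod => u; rewrite /face_map /=.
apply: (cD (fun x => _ + _) (fun x => _)).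
  apply: (cD (fun x => _) (fun x => _)).
    by apply: (cM _ _) => //; apply: max_continuous2 => //; apply: (cB _ _) => //; apply: (cM _ _).
  apply: (cM (fun x => _) (fun x => _)).
    by apply: min_continuous2 => //; apply: (cM _ _).
  apply: continuous_bigsum => j; apply: (cM _ _) => //; rewrite /inner_hat.
  apply: max_continuous2 => //; apply: min_continuous2 => //.
  by apply: min_continuous2; [apply: (cB _ _) => //; apply: cB|apply: (cD _ _) => //; apply: (cB _ _)].
apply: continuous_bigsum => j; apply: (cM _ _) => //; rewrite /outer_hat.
apply: max_continuous2 => //; apply: min_continuous2.
  by apply: (cD _ _) => //; apply: (cB _ _).
apply: min_continuous2; first exact: (cB _ _).
by apply: (cB _ _); apply: (cB _ _).
Qed.

(** This formula and the next two give [face_map] in barycentric coordinates on [tri3], [tri1] and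
    [tri2] respectively; the diagonal t = 2r - 1 separates the last two. *)
Lemma face_map_inner r k t c u : 0 <= r -> 2 * r <= 1 -> (k < len D)%N ->
  0 <= t -> t <= 1 ->
  face_map c (r, k%:R + t) u = (2 * r * (1 - t)) * (u == rr c (walk D c k))%:R
    + (2 * r * t) * (u == rr c (step c (walk D c k)))%:R + (1 - 2 * r) * (u == ff D c)%:R.
Proof.
move=> r0 r1 kL t0 t1; rewrite face_mapE ?t0 ?t1 // ?r0 /= ?walkS; last by clear -r1; lra.
have -> : Num.max 0 (1 - 2 * r) = 1 - 2 * r by rewrite max_r; [|clear -r1; lra].
have -> : Num.min 1 (2 - 2 * r) = 1 by rewrite min_l; [|clear -r1; lra].
have -> : Num.min 1 (2 * r) = 2 * r by rewrite min_r.
have -> : Num.min 1 (1 - t) = 1 - t by rewrite min_r; [|clear -t0; lra].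
have -> : Num.max 0 (t + 1 - 1) = t by rewrite max_r; [|clear -t0]; lra.
have -> : Num.max 0 (1 - 1 - t) = 0 by rewrite max_l; [|clear -t0; lra].
have -> : Num.min t (1 - 1) = 0 by rewrite min_r; [|clear -t0]; lra.
by rewrite !mul0r !addr0 mulrDr !mulrA addrC.
Qed.

Lemma face_map_up r k t c u : 1 <= 2 * r -> r <= 1 -> (k < len D)%N ->
  0 <= t -> t <= 2 * r - 1 ->
  face_map c (r, k%:R + t) u = (2 - 2 * r) * (u == rr c (walk D c k))%:R
    + (2 * r - 1 - t) * (u == vv D (tl (walk D c k)))%:R
    + t * (u == vv D (hd (walk D c k)))%:R.
Proof.
move=> r0 r1 kL t0 tr; have t1 : t <= 1 by clear -tr r1; lra.
rewrite face_mapE ?t0 ?t1 // ?r1 ?andbT /= ?walkS; last by clear -r0; lra.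
have -> : Num.max 0 (1 - 2 * r) = 0 by rewrite max_l; [|clear -r0; lra].
have -> : Num.min 1 (2 - 2 * r) = 2 - 2 * r by rewrite min_r; [|clear -r0; lra].
have -> : Num.min 1 (2 * r) = 1 by rewrite min_l.
have -> : Num.min (2 - 2 * r) (1 - t) = 2 - 2 * r by rewrite min_l; [|clear -tr; lra].
have -> : Num.max 0 (t + (2 - 2 * r) - 1) = 0 by rewrite max_l; [|clear -tr; lra].
have -> : Num.max 0 (1 - (2 - 2 * r) - t) = 2 * r - 1 - t.
  by rewrite max_r; clear -tr; lra.
have -> : Num.min t (1 - (2 - 2 * r)) = t by rewrite min_l; [|clear -tr; lra].
by rewrite !mul0r !addr0 add0r mul1r addrA.
Qed.

Lemma face_map_down r k t c u : 1 <= 2 * r -> r <= 1 -> (k < len D)%N ->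
  2 * r - 1 <= t -> t <= 1 ->
  face_map c (r, k%:R + t) u = (1 - t) * (u == rr c (walk D c k))%:R
    + (2 * r - 1) * (u == vv D (hd (walk D c k)))%:R
    + (t + 1 - 2 * r) * (u == rr c (step c (walk D c k)))%:R.
Proof.
move=> r0 r1 kL tr t1; have t0 : 0 <= t by clear -tr r0; lra.
rewrite face_mapE ?t0 ?t1 // ?r1 ?andbT /= ?walkS; last by clear -r0; lra.
have -> : Num.max 0 (1 - 2 * r) = 0 by rewrite max_l; [|clear -r0; lra].
have -> : Num.min 1 (2 - 2 * r) = 2 - 2 * r by rewrite min_r; [|clear -r0; lra].
have -> : Num.min 1 (2 * r) = 1 by rewrite min_l.
have -> : Num.min (2 - 2 * r) (1 - t) = 1 - t by rewrite min_r; [|clear -tr; lra].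
have -> : Num.max 0 (t + (2 - 2 * r) - 1) = t + 1 - 2 * r.
  by rewrite max_r; clear -tr; lra.
have -> : Num.max 0 (1 - (2 - 2 * r) - t) = 0.
  by rewrite max_l; [|clear -tr; lra].
have -> : Num.min t (1 - (2 - 2 * r)) = 2 * r - 1 by rewrite min_r; clear -tr; lra.
rewrite !mul0r add0r mul1r; ring.
Qed.

Lemma rect_cases x : rect (len D) x -> exists k t, [/\ (k < len D)%N,
  x = (x.1, k%:R + t), 0 <= x.1 & x.1 <= 1] /\ [/\ 0 <= t, t <= 1
  & [\/ 2 * x.1 <= 1, 1 <= 2 * x.1 /\ t <= 2 * x.1 - 1
      | 1 <= 2 * x.1 /\ 2 * x.1 - 1 <= t]].
Proof.
case: x => r s /rectP[/= /andP[r0 r1] s0L].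
have L0 : (0 < len D)%N by have := len_gt2 D; lia.
have [k [t [kL /andP[t0 t1] ->]]] := nat_frac L0 s0L.
exists k, t; split; [by []|split=> //].
have [r2|r2] := leP (2 * r) 1; first by constructor 1.
by have [tr|tr] := leP t (2 * r - 1); [constructor 2|constructor 3]; split=> //; exact: ltW.
Qed.

Lemma weights_in (A B C : mapW D) (a b d : R) (p : {ptws mapW D -> R}) :
  [set A; B; C]%SET \in cplx K -> 0 <= a -> 0 <= b -> 0 <= d -> a + b + d = 1 ->
  (forall u, p u = a * (u == A)%:R + b * (u == B)%:R + d * (u == C)%:R) -> X p.
Proof.
move=> ABC a0 b0 d0 abd pE; apply: (realizationI ABC) => [u||u].
- by rewrite pE !addr_ge0 // mulr_ge0.
- by under eq_bigr do rewrite pE; rewrite !big_split /= -!mulr_sumr !sum_eq1 !mulr1.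
- rewrite pE !inE; case: (u == A) => //; case: (u == B) => //.
  by case: (u == C); rewrite // !mulr0 !addr0 eqxx.
Qed.

Lemma tri1_in c e : tri1 c e \in cplx K.
Proof.
apply: (@tri_cplx _ _ _ c e); last by constructor 1.
by apply/set0Pn; exists (rr c e); rewrite !inE eqxx.
Qed.

Lemma tri2_in c e : tri2 c e \in cplx K.
Proof.
apply: (@tri_cplx _ _ _ c e); last by constructor 2.
by apply/set0Pn; exists (rr c e); rewrite !inE eqxx.
Qed.

Lemma tri3_in c e : tri3 c e \in cplx K.
Proof.
apply: (@tri_cplx _ _ _ c e); last by constructor 3.
by apply/set0Pn; exists (rr c e); rewrite !inE eqxx.
Qed.

Lemma face_map_in c x : rect (len D) x -> X (face_map c x).
Proof.
move=> /rect_cases[k [t [[kL -> r0 r1] [t0 t1]]]].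
case: x r0 r1 => r s /= r0 r1; case=> [r2|[r2 tr]|[r2 tr]].
- apply: (weights_in (tri3_in c (walk D c k)) _ _ _ _
    (fun u => face_map_inner c u r0 r2 kL t0 t1)).
  + by rewrite !mulr_ge0 // subr_ge0.
  + by rewrite !mulr_ge0.
  + by rewrite subr_ge0.
  + by ring.
- apply: (weights_in (tri1_in c (walk D c k)) _ _ _ _
    (fun u => face_map_up c u r2 r1 kL t0 tr)) => //.
  + by clear -r1; lra.
  + by rewrite subr_ge0.
  + by ring.
- apply: (weights_in (tri2_in c (walk D c k)) _ _ _ _
    (fun u => face_map_down c u r2 r1 kL tr t1)).
  + by rewrite subr_ge0.
  + by rewrite subr_ge0.
  + by clear -tr; lra.
  + by ring.
Qed.

End FaceMapFormulas.

Section FaceImage.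
Variables (R : realType) (V : finType) (D : edge_map V).
Implicit Types (c : bool) (x y : R * R) (u : mapW D) (k : nat) (e : D) (r s t : R).
Local Notation K := (map_links D).
Local Notation X := (realization R (cplx K)).
Local Notation face_map := (@face_map R V D).

Definition in_face c u : bool :=
  match u with
  | inl (inl _) => false
  | inl (inr (c', _)) => c' == c
  | inr c' => c' == c
  end.

(** Total weight of the vertices interior to the face [c]. It vanishes on the graph and on the other
    face, so its positivity cuts out the open face. *)
Definition face_weight c (p : {ptws mapW D -> R}) : R :=
  \sum_(u | in_face c u) p u.

Lemma face_weight3 c (A B C : mapW D) (a b d : R) (p : {ptws mapW D -> R}) :
  (forall u, p u = a * (u == A)%:R + b * (u == B)%:R + d * (u == C)%:R) ->
  face_weight c p = a * (in_face c A)%:R + b * (in_face c B)%:R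
    + d * (in_face c C)%:R.
Proof.
move=> pE.
have S (w : mapW D) : \sum_(u | in_face c u) (u == w)%:R = (in_face c w)%:R :> R.
  rewrite big_mkcond (bigD1 w) //= eqxx big1 ?addr0; first by case: in_face.
  by move=> u /negPf ->; case: in_face.
rewrite /face_weight; under eq_bigr do rewrite pE.
by rewrite !big_split /= -!mulr_sumr !S.
Qed.

Lemma face_map_weight c c' x : rect (len D) x ->
  face_weight c' (face_map c x) = Num.min 1 (2 - 2 * x.1) * (c == c')%:R.
Proof.
move=> /rect_cases[k [t [[kL -> r0 r1] [t0 t1]]]].
case: x r0 r1 => r s /= r0 r1; case=> [r2|[r2 tr]|[r2 tr]].
- rewrite (face_weight3 c' (fun u => face_map_inner c u r0 r2 kL t0 t1)) /=.
  have -> : Num.min 1 (2 - 2 * r) = 1 by rewrite min_l; [|clear -r2; lra].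
  by ring.
- rewrite (face_weight3 c' (fun u => face_map_up c u r2 r1 kL t0 tr)) /=.
  have -> : Num.min 1 (2 - 2 * r) = 2 - 2 * r by rewrite min_r; [|clear -r2; lra].
  by ring.
- rewrite (face_weight3 c' (fun u => face_map_down c u r2 r1 kL tr t1)) /=.
  have -> : Num.min 1 (2 - 2 * r) = 2 - 2 * r by rewrite min_r; [|clear -r2; lra].
  by ring.
Qed.

Section Coordinates.
Variables (c : bool) (r t : R) (k : nat).
Hypotheses (r01 : 0 <= r <= 1) (kL : (k < len D)%N) (t01 : 0 <= t <= 1).
Let y := Num.min 1 (2 - 2 * r).

Lemma face_map_rr e : face_map c (r, k%:R + t) (rr c e) =
  Num.min 1 (2 * r) * (Num.min y (1 - t) * (e == walk D c k)%:R
    + Num.max 0 (t + y - 1) * (e == walk D c k.+1)%:R).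
Proof.
have E (e' : D) : (rr c e == rr c e') = (e == e').
  by apply/eqP/eqP => [[]|->].
by rewrite face_mapE // !E /= !mulr0 !addr0 add0r.
Qed.

Lemma face_map_vv v : face_map c (r, k%:R + t) (vv D v) =
  Num.max 0 (1 - y - t) * (v == tl (walk D c k))%:R
    + Num.min t (1 - y) * (v == hd (walk D c k))%:R.
Proof.
have E v' : (vv D v == vv D v') = (v == v') by apply/eqP/eqP => [[]|->].
by rewrite face_mapE // !E /= !mulr0 !addr0 mulr0 !add0r.
Qed.

Lemma face_map_ff : face_map c (r, k%:R + t) (ff D c) = Num.max 0 (1 - 2 * r).
Proof. by rewrite face_mapE // eqxx /= !mulr0 !addr0 mulr0 addr0 mulr1. Qed.

End Coordinates.

Lemma closing_position : (len D)%:R = (len D).-1%:R + 1 :> R.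
Proof. by have := len_gt2 D; rewrite natr1 => L2; rewrite prednK //; lia. Qed.

Lemma face_map_closed c r : 0 <= r <= 1 ->
  face_map c (r, (len D)%:R) = face_map c (r, 0).
Proof.
move=> r01; apply/funext => u; rewrite closing_position.
have -> : face_map c (r, 0) u = face_map c (r, 0%:R + 0) u by rewrite addr0.
have L2 := len_gt2 D.
have wE : walk D c (len D).-1.+1 = walk D c 0 by rewrite prednK ?walk_closed //; lia.
rewrite !face_mapE ?lexx ?ler01 //; try lia.
rewrite /= -(tl_step c (walk D c (len D).-1)) -walkS wE.
have /andP[r0 r1] := r01; set y := Num.min 1 (2 - 2 * r).
have y0 : 0 <= y by rewrite le_min ler01 /=; clear -r1; lra.
have y1 : y <= 1 by rewrite ge_min lexx.
have -> : Num.min y (1 - 1) = 0 by rewrite subrr min_r.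
have -> : Num.max 0 (1 + y - 1) = y by rewrite addrAC subrr add0r max_r.
have -> : Num.max 0 (1 - y - 1) = 0 by rewrite max_l; [|clear -y0; lra].
have -> : Num.min 1 (1 - y) = 1 - y by rewrite min_r; [|clear -y0; lra].
have -> : Num.min y (1 - 0) = y by rewrite subr0 min_l.
have -> : Num.max 0 (0 + y - 1) = 0 by rewrite max_l; [|clear -y1; lra].
have -> : Num.max 0 (1 - y - 0) = 1 - y by rewrite max_r; clear -y1; lra.
have -> : Num.min 0 (1 - y) = 0 by rewrite min_l; [|clear -y1; lra].
by ring.
Qed.

Lemma hat_sum (y t : R) : Num.min t (1 - y) + Num.max 0 (t + y - 1) = t.
Proof. by minmax. Qed.

(** Graph vertices may recur along the walk, so the sector is identified by ring vertices: the
    weight at [walk D c k] is positive as long as t < 1. Within the sector, [t] is the sum of the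
    weights of the head and of the next ring vertex, by [hat_sum]. *)
Lemma face_map_inj_angle c r s s' : 0 < r -> r < 1 ->
  0 <= s < (len D)%:R -> 0 <= s' < (len D)%:R ->
  face_map c (r, s) = face_map c (r, s') -> s = s'.
Proof.
move=> r0 r1 /nat_frac_lt[k [t [kL /andP[t0 t1] ->]]].
move=> /nat_frac_lt[l [t' [lL /andP[t'0 t'1] ->]]] ss'.
have r01 : 0 <= r <= 1 by rewrite !ltW.
have t01 : 0 <= t <= 1 by rewrite t0 ltW.
have t01' : 0 <= t' <= 1 by rewrite t'0 ltW.
have m0 : 0 < Num.min 1 (2 * r) by rewrite lt_min ltr01 mulr_gt0.
have L2 := len_gt2 D.
have wc := walk_closed D c; have wi := @walk_inj _ D c.
have pos k' (t'' : R) : t'' < 1 ->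
    0 < Num.min 1 (2 * r) * Num.min (Num.min 1 (2 - 2 * r)) (1 - t'').
  move=> t''1; rewrite mulr_gt0 // !lt_min ltr01 /= !subr_gt0 t''1 andbT.
  by clear -r1; lra.
have kl : k = l.
  apply: (closed_adj L2 wc wi) => //.
    have := congr1 (@^~ (rr c (walk D c k))) ss'.
    rewrite /= !face_map_rr // eqxx (negPf (closed_neqS L2 wc wi kL)) mulr0 addr0 mulr1.
    case: eqP => [->|_]; first by left.
    case: eqP => [->|_]; first by right.
    by rewrite !mulr0 addr0 mulr0 => h; have := pos k t t1; rewrite h ltxx.
  have := congr1 (@^~ (rr c (walk D c l))) ss'.
  rewrite /= !face_map_rr // eqxx (negPf (closed_neqS L2 wc wi lL)) mulr0 addr0 mulr1.
  case: eqP => [->|_]; first by left.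
  case: eqP => [->|_]; first by right.
  by rewrite !mulr0 addr0 mulr0 => h; have := pos l t' t'1; rewrite -h ltxx.
move: ss'; rewrite -{}kl => ss'; congr (_ + _).
have /eqP hn := @tl_neq_hd _ _ (walk D c k).
have := congr1 (@^~ (vv D (hd (walk D c k)))) ss'.
rewrite /= !face_map_vv // eqxx eq_sym (negPf hn) !mulr0 !add0r !mulr1 => h1.
have := congr1 (@^~ (rr c (walk D c k.+1))) ss'.
rewrite /= !face_map_rr // eqxx eq_sym (negPf (closed_neqS L2 wc wi kL)).
rewrite !mulr0 !add0r !mulr1 => /(mulfI (lt0r_neq0 m0)) h2.
by rewrite -(hat_sum (Num.min 1 (2 - 2 * r)) t) h1 h2 hat_sum.
Qed.

(** The weight of the centre determines radii up to 1/2, and the face weight determines those from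
    1/2 on. *)
Lemma face_map_radius c x y : rect (len D) x -> rect (len D) y ->
  face_map c x = face_map c y -> x.1 = y.1.
Proof.
move=> rx ry xy; have := congr1 (face_weight c) xy.
rewrite !face_map_weight // eqxx !mulr1.
have /rect_cases[k [t [[kL xE r0 r1] [t0 t1 _]]]] := rx.
have /rect_cases[l [s [[lL yE q0 q1] [s0 s1 _]]]] := ry.
have := congr1 (@^~ (ff D c)) xy; rewrite xE yE /= !face_map_ff ?r0 ?q0 ?t0 ?s0 //.
move: x.1 y.1 => a b; clear; case: (leP 0 (1 - 2 * a)) => ?;
  case: (leP 0 (1 - 2 * b)) => ?; case: (leP 1 (2 - 2 * a)) => ?;
  case: (leP 1 (2 - 2 * b)) => ?; lra.
Qed.

(** Radius 1 is excluded for [x], since the boundary walk may return to a graph vertex. *)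
Lemma face_mapP c x y : rect (len D) x -> rect (len D) y -> x.1 < 1 ->
  face_map c x = face_map c y -> same_polar (len D) x y.
Proof.
move=> rx ry x1 xy; have rE := face_map_radius rx ry xy.
have /rectP[/andP[x0 _] x2] := rx; have /rectP[_ y2] := ry.
split=> //; have [x10|x10] := eqVneq x.1 0; first by constructor 1.
have x1_gt0 : 0 < x.1 by rewrite lt_def x10.
have x01 : 0 <= x.1 <= 1 by rewrite x0 ltW.
have [||||h|h|h] := @periodic_inj R _ (len D) (fun s => face_map c (x.1, s)) _ _ _ x.2 y.2 x2 y2.
- by have := len_gt2 D; lia.
- exact: face_map_closed.
- by move=> s t s0 t0; exact: face_map_inj_angle.
- by rewrite -surjective_pairing xy rE -surjective_pairing.
- by constructor 2.
- by constructor 3.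
- by constructor 4.
Qed.

Lemma face_map_same c x y : rect (len D) x -> same_polar (len D) x y ->
  rect (len D) y -> face_map c x = face_map c y.
Proof.
move=> rx [x1 h] ry; have /rectP[r01 x2] := rx; have /rectP[_ y2] := ry.
rewrite (surjective_pairing x) (surjective_pairing y) -x1.
case: h => [x0|->|[-> ->]|[-> ->]] //; rewrite ?face_map_closed //.
have L0 : (0 < len D)%N by have := len_gt2 D; lia.
have [k [t [kL /andP[t0 t1] ->]]] := nat_frac L0 x2.
have [l [s [lL /andP[s0 s1] ->]]] := nat_frac L0 y2.
apply/funext => u; rewrite x0.
rewrite !face_map_inner ?mulr0 ?ler01 //.
by rewrite !mul0r.
Qed.

(** Every edge is some [walk D c k], so each triangle is one of those on which [face_map] has an
    explicit barycentric formula; the witnesses solve that formula for radius and angle. *)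
Lemma face_map_onto (p : {ptws mapW D -> R}) : X p ->
  exists c x, rect (len D) x /\ face_map c x = p.
Proof.
move=> [p0 p1 /map_simplexP[c [e]]].
have [k kL <-] := walk_surj c e.
have kL1 : k%:R + 1 <= (len D)%:R :> R by rewrite natr1 ler_nat.
have k0 : 0 <= k%:R :> R by [].
have sup (A : {set mapW D}) : [set w | p w != 0]%SET \subset A ->
    forall u, p u != 0 -> u \in A.
  by move=> /fintype.subsetP sA u pu; apply: sA; rewrite inE.
have rectI r t : 0 <= r <= 1 -> 0 <= t <= 1 -> rect (len D) (r, k%:R + t).
  by move=> r01 /andP[t0 t1]; apply/rectP; rewrite /= r01; split=> //; clear -t0 t1 kL1 k0; lra.
case=> /sup {}sup; exists c.
- have pE := support3 (tri1_uniq c (walk D c k)) sup.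
  move: p1; rewrite (sum_support3 (tri1_uniq c (walk D c k)) sup).
  have := p0 (rr c (walk D c k)); have := p0 (vv D (tl (walk D c k))).
  have := p0 (vv D (hd (walk D c k))); move: pE.
  move: (p (rr _ _)) (p (vv _ (tl _))) (p (vv _ (hd _))) => a b d pE d0 b0 a0 abd.
  exists (1 - a / 2, k%:R + d); split.
    by apply: rectI; clear -a0 b0 d0 abd; lra.
  apply/funext => u; rewrite face_map_up //; try by clear -a0 b0 d0 abd; lra.
  by rewrite pE; congr (_ * _ + _ * _ + _ * _); clear -abd; lra.
- have pE := support3 (tri2_uniq c (walk D c k)) sup.
  move: p1; rewrite (sum_support3 (tri2_uniq c (walk D c k)) sup).
  have := p0 (rr c (walk D c k)); have := p0 (vv D (hd (walk D c k))).
  have := p0 (rr c (step c (walk D c k))); move: pE.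
  move: (p (rr _ (step _ _))) (p (rr _ _)) (p (vv _ _)) => d a b pE d0 b0 a0 abd.
  exists ((1 + b) / 2, k%:R + (1 - a)); split.
    by apply: rectI; clear -a0 b0 d0 abd; lra.
  apply/funext => u; rewrite face_map_down //; try by clear -a0 b0 d0 abd; lra.
  by rewrite pE; congr (_ * _ + _ * _ + _ * _); clear -abd; lra.
- have pE := support3 (tri3_uniq c (walk D c k)) sup.
  move: p1; rewrite (sum_support3 (tri3_uniq c (walk D c k)) sup).
  have := p0 (rr c (walk D c k)); have := p0 (ff D c).
  have := p0 (rr c (step c (walk D c k))); move: pE.
  move: (p (rr _ (step _ _))) (p (rr _ _)) (p (ff _ _)) => b a d pE b0 d0 a0 abd.
  (* At the centre, d = 1, the angle is free and 0 is chosen. *)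
  have [t [t0 t1 ta tb]] : exists t, [/\ 0 <= t, t <= 1, (1 - d) * (1 - t) = a & (1 - d) * t = b].
    have [d1|d1] := eqVneq d 1.
      by exists 0; rewrite d1 subrr !mul0r; split; clear -a0 b0 d0 abd d1; lra.
    have d1' : 0 < 1 - d.
      by rewrite lt_def subr_eq0 eq_sym d1 /=; clear -a0 b0 abd; lra.
    exists (b / (1 - d)); split.
    + by rewrite divr_ge0 // ltW.
    + by rewrite ler_pdivrMr // mul1r; clear -a0 abd; lra.
    + rewrite mulrBr mulr1 mulrC divfK ?lt0r_neq0 //; clear -abd; lra.
    + by rewrite mulrC divfK ?lt0r_neq0.
  exists ((1 - d) / 2, k%:R + t); split.
    by apply: rectI; rewrite ?t0 //; clear -a0 b0 d0 abd; lra.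
  apply/funext => u; rewrite face_map_inner //; try by clear -a0 b0 d0 abd; lra.
  have -> : 2 * ((1 - d) / 2) = 1 - d by clear; lra.
  by rewrite ta tb pE opprB addrCA subrr addr0.
Qed.

End FaceImage.

(** * Faces of the map *)

Section Faces.
Variables (R : realType) (V : finType) (D : edge_map V).
Implicit Types (c : bool) (x y : R * R) (u : mapW D) (k : nat).
Local Notation K := (map_links D).
Local Notation X := (realization R (cplx K)).
Local Notation M := (set_type X).
Local Notation toM := (@toM R _ K (ff D true)).
Local Notation face_map := (@face_map R V D).

Definition face_set c : set M :=
  [set z | 0 < face_weight c (\val z : {ptws mapW D -> R})].

Let open_rect : set (R * R) := rect (len D) `&` [set x | x.1 < 1].

Lemma len_gt0 : (0 < len D)%N.
Proof. by have := len_gt2 D; lia. Qed.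

Lemma toM_face_map_continuous c : {within rect (len D), continuous toM \o face_map c}.
Proof.
apply: toM_comp_continuous; first exact: face_map_in.
by apply: continuous_subspaceT; exact: face_map_continuous.
Qed.

Lemma polyhedron_cover (z : M) : exists c x, rect (len D) x /\ z = toM (face_map c x).
Proof.
have [c [x [rx xE]]] := face_map_onto (valM_in z).
by exists c, x; split=> //; rewrite xE valK_toM.
Qed.

Lemma face_set_face_map c c' x : rect (len D) x ->
  face_set c' (toM (face_map c x)) <-> c = c' /\ x.1 < 1.
Proof.
move=> rx; rewrite /face_set /= toMK; last exact: face_map_in.
rewrite face_map_weight //; case: eqP => [->|cc']; last first.
  by rewrite mulr0 ltxx; split=> // -[].
rewrite mulr1 lt_min ltr01 subr_gt0 /=.
have -> : (2 * x.1 < 2) = (x.1 < 1) by apply/idP/idP; lra.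
by split=> [|[]].
Qed.

Lemma face_image c : (toM \o face_map c) @` open_rect = face_set c.
Proof.
rewrite eqEsubset; split=> [_ [x [rx x1] <-]|z].
  by apply/face_set_face_map.
have [c' [x [rx ->]]] := polyhedron_cover z.
by move=> /(face_set_face_map _ _ rx)[-> x1]; exists x.
Qed.

Lemma face_set_open c : open (face_set c).
Proof.
exists [set p : {ptws mapW D -> R} | 0 < face_weight c p] => //.
apply: (@open_comp _ _ (@face_weight R V D c) [set x | 0 < x]).
  move=> p _; rewrite /face_weight.
  under [X in continuous_at _ X]eq_fun do rewrite -big_filter.
  by apply: continuous_bigsum => w; exact: eval_continuous.
exact: open_gt.
Qed.

Lemma face_set_disjoint : face_set true `&` face_set false = set0.
Proof.
rewrite -subset0 => z [zt zf]; have [c [x [rx zE]]] := polyhedron_cover z.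
move: zt zf; rewrite zE => /(face_set_face_map _ _ rx)[ct _].
by move=> /(face_set_face_map _ _ rx)[cf _]; rewrite ct in cf.
Qed.

Lemma face_map_center c s : 0 <= s <= (len D)%:R ->
  face_map c (0, s) = face_map c (0, 0).
Proof.
move=> s0L; apply: face_map_same.
- by apply/rectP; rewrite /= lexx ler01.
- by split=> //; constructor 1.
- by apply/rectP; rewrite /= !lexx ler01 ler0n.
Qed.

(* The image of a star-shaped part of the disc is a union of radii through the
   centre of the face. *)
Lemma radial_connected c (I : interval R) : [set` I] 0 ->
  [set` I] `<=` `[0, 1]%classic ->
  connected ((toM \o face_map c) @` ([set` I] `*` `[0, (len D)%:R])).
Proof.
move=> I0 I01.
have -> : (toM \o face_map c) @` ([set` I] `*` `[0, (len D)%:R]) =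
    \bigcup_(s in `[0, (len D)%:R]%classic)
      ((fun r => toM (face_map c (r, s))) @` [set` I]).
  rewrite eqEsubset; split=> [_ [[r s] [/= Ir sL] <-]|_ [s sL [r Ir <-]]].
    by exists s => //; exists r.
  by exists (r, s).
apply: bigcup_connected.
  exists (toM (face_map c (0, 0))) => s /=; rewrite in_itv /= => sL.
  by exists 0 => //; rewrite face_map_center.
move=> s /=; rewrite in_itv /= => sL.
apply: connected_continuous_connected.
  by apply/connected_intervalP; exact: interval_is_interval.
apply: toM_comp_continuous => [r /I01|].
  by rewrite /= in_itv /= => r01; apply: face_map_in; apply/rectP.
apply: continuous_subspaceT => r.
apply: (@continuous_comp _ _ _ (fun r => (r, s)) (face_map c)).
  exact: (@cvg_pair _ _ _ _ (nbhs r) (nbhs s) _ _ _ id (fun=> s) cvg_id (cvg_cst s)).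
exact: face_map_continuous.
Qed.

Lemma face_set_connected c : connected (face_set c).
Proof.
rewrite -face_image.
have -> : open_rect = [set` `[0, 1[] `*` `[0, (len D)%:R].
  rewrite eqEsubset; split=> [x [/rectP[/andP[x0 _] x2] /= x1]|x [/= x1 x2]].
    by split; rewrite /= in_itv /= ?x0.
  rewrite in_itv /= in x1; rewrite in_itv /= in x2; have /andP[x0 x1'] := x1.
  by split=> //; apply/rectP; rewrite x0 ltW.
apply: radial_connected; first by rewrite /= in_itv /= lexx ltr01.
by move=> r /=; rewrite !in_itv /= => /andP[-> /ltW].
Qed.

Lemma face_set_neq0 c : face_set c !=set0.
Proof.
exists (toM (face_map c (0, 0))); apply/face_set_face_map; last by split=> //=.
by apply/rectP; rewrite /= !lexx ler01 ler0n.
Qed.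

(** The two closed faces meet: the first edge of the [true] walk also occurs in the [false] walk,
    and both parametrizations reach its tail at radius 1. *)
Lemma polyhedron_connected : connected [set: M].
Proof.
have -> : [set: M] = (toM \o face_map true) @` (`[0, 1] `*` `[0, (len D)%:R]) `|`
    (toM \o face_map false) @` (`[0, 1] `*` `[0, (len D)%:R]).
  rewrite eqEsubset; split=> // z _; have [[] [x [rx ->]]] := polyhedron_cover z.
    by left; exists x.
  by right; exists x.
apply: connectedU.
- have [l lL lE] := walk_surj false (walk D true 0).
  have s0 : 0 <= (0%:R + 0 : R) <= (len D)%:R by rewrite addr0 lexx ler0n.
  have s1 : 0 <= (l%:R + 0 : R) <= (len D)%:R by rewrite addr0 ler0n ler_nat ltnW.
  exists (toM (face_map true (1, 0%:R + 0))); split.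
    by exists (1, 0%:R + 0) => //; split; rewrite /= in_itv //= lexx ler01.
  exists (1, l%:R + 0); first by split; rewrite /= in_itv //= lexx ler01.
  rewrite /=; congr toM; apply/funext => u.
  rewrite !face_map_up ?len_gt0 //; try lra.
  by rewrite lE; ring.
- by apply: radial_connected; rewrite //= in_itv /= lexx ler01.
- by apply: radial_connected; rewrite //= in_itv /= lexx ler01.
Qed.

Lemma face_map_polar c x y : rect (len D) x -> rect (len D) y -> x.1 < 1 ->
  toM (face_map c x) = toM (face_map c y) <-> polar (len D) x = polar (len D) y.
Proof.
move=> rx ry x1; rewrite polarE ?len_gt0 //; split=> [|h].
  by move=> /toM_inj h; apply: face_mapP => //; apply: h; exact: face_map_in.
by rewrite (face_map_same c rx h ry).
Qed.

Lemma face_set_disc c : homeomorphic (face_set c) (@open_disc R).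
Proof.
rewrite -face_image -(polar_image_open R len_gt0).
apply: (@homeomorphic_images _ _ _ (rect (len D))) => //.
- exact: polyhedron_hausdorff.
- exact: rect_compact.
- exact: toM_face_map_continuous.
- by apply: continuous_subspaceT; exact: polar_continuous.
- by move=> x [].
- exists (0, 0); split=> /=; last exact: ltr01.
  by apply/rectP; rewrite /= lexx ler01 ler0n.
- move=> x y rx [ry /= y1] /esym/face_map_polar -/(_ ry rx y1).
  by move=> /(polarE len_gt0 ry rx)[yx _]; split=> //=; rewrite -yx.
- by move=> x y rx [ry /= y1] /(polarE len_gt0 rx ry)[xy _]; split=> //=; rewrite xy.
- by move=> x y [rx /= x1] [ry _]; exact: face_map_polar.
Qed.

(** [face_map c] is constant on the fibres of [polar] and so descends to the closed disc, where it
    is injective in the interior. On the unit circle, [g] gives the parametrization that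
    [face_boundary] asks for. *)
Lemma face_chart c : exists g : R * R -> M,
  [/\ {within @closed_disc R, continuous g}, set_bij (@open_disc R) (face_set c) g
    & forall x, rect (len D) x -> g (polar (len D) x) = toM (face_map c x)].
Proof.
have [g [cg gE]] := @quotient_map_factor _ _ _ (rect (len D)) (@polar R (len D))
  (toM \o face_map c) (toM (face_map c (0, 0))) (@norm_hausdorff R (R * R)%type)
  (@rect_compact R (len D)) (continuous_subspaceT (@polar_continuous R (len D)))
  (@toM_face_map_continuous c)
  (fun x y rx ry h => congr1 toM (face_map_same c rx ((polarE len_gt0 rx ry).1 h) ry)).
rewrite polar_image ?len_gt0 // in cg.
exists g; split=> //; rewrite -(polar_image_open R len_gt0) -face_image; split.
- by move=> _ [x [rx x1] <-]; rewrite gE //; exists x.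
- move=> _ _ /set_mem[x [rx x1] <-] /set_mem[y [ry y1] <-]; rewrite !gE //=.
  by move=> /face_map_polar; exact.
- by move=> _ [x [rx x1] <-]; exists (polar (len D) x); [exists x|rewrite gE].
Qed.

End Faces.

(** * The embedded graph *)

(** Inside the component, A is open, and it is closed as the complement of B; connectedness leaves
    nothing else. *)
Lemma component_of_two (T : topologicalType) (A B : set T) (x : T) :
  open A -> open B -> A `&` B = set0 -> connected A -> A x ->
  connected_component (A `|` B) x = A.
Proof.
move=> oA oB AB cA Ax; rewrite eqEsubset; split; last first.
  by apply: connected_component_max => // y; left.
have cC := @component_connected _ (A `|` B) x.
have sC := @connected_component_sub _ (A `|` B) x.
set C := connected_component _ _ in cC sC *.
have -> : C = C `&` A; last by move=> y [].
apply/esym; apply: cC.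
- by exists x; split=> //; apply: connected_component_refl; left.
- by exists A.
- exists (~` B); first exact: open_closedC.
  rewrite eqEsubset; split=> y [Cy].
    by move=> Ay; split=> // By; have : (A `&` B) y by []; rewrite AB.
  by move=> nBy; split=> //; case: (sC _ Cy).
Qed.

Lemma circuit_edges_nth (V : finType) (v0 : V) (c : seq V) : circuit_edges c =
  mkseq (fun k => [set nth v0 c k; nth v0 c (k.+1 %% size c)]%SET) (size c).
Proof.
rewrite /circuit_edges /mkseq -[in RHS]val_enum_ord -map_comp.
by apply: eq_map => k; rewrite /= !(tnth_nth v0).
Qed.

Section Graph.
Variables (R : realType) (V : finType) (D : edge_map V) (e : rel V).
Hypothesis eP : forall u v, e u v <->
  exists b : D, (tl b = u /\ hd b = v) \/ (tl b = v /\ hd b = u).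
Implicit Types (c : bool) (x y : R * R) (k : nat) (p q : {ptws V -> R}).
Local Notation K := (map_links D).
Local Notation X := (realization R (cplx K)).
Local Notation M := (set_type X).
Local Notation toM := (@toM R _ K (ff D true)).
Local Notation face_map := (@face_map R V D).
Local Notation face_set := (@face_set R V D).

Definition extend p : {ptws mapW D -> R} :=
  fun u => if u is inl (inl v) then p v else 0.

Definition emb p : M := toM (extend p).

Lemma graph_complexP (A : {set V}) : A \in graph_complex e <->
  (exists v, A = [set v]%SET) \/ exists b : D, A = [set tl b; hd b]%SET.
Proof.
rewrite /graph_complex /graph_edges finset.in_setU; split.
  case/orP => /finset.imsetP[x]; first by move=> _ ->; left; exists x.
  rewrite inE => /eP[b [[<- <-]|[<- <-]]] ->; right; exists b => //.
  by rewrite finset.setUC.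
case=> [[v ->]|[b ->]]; apply/orP; [left|right].
  by apply/finset.imsetP; exists v.
apply/finset.imsetP; exists (tl b, hd b) => //.
by rewrite inE; apply/eP; exists b; left.
Qed.

Lemma sum_extend p : \sum_u extend p u = \sum_v p v.
Proof.
rewrite big_sumType /= [X in _ + X]big1 // addr0.
by rewrite big_sumType /= [X in _ + X]big1 ?addr0.
Qed.

Lemma extend_in p : graph_space R e p -> X (extend p).
Proof.
move=> [p0 p1 pG].
have ext0 u : 0 <= extend p u by case: u => [[v|?]|?] //=.
have ext1 : \sum_u extend p u = 1 by rewrite sum_extend.
case/graph_complexP: pG => [[v suppE]|[b suppE]].
- have vK : [set vv D v]%SET \in cplx K.
    have v3 : (0 < sz K (vv D v))%N by have := sz_gt2 K (vv D v); lia.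
    apply: simplex_link v3 _ _; first by apply/set0Pn; exists (vv D v); rewrite inE.
    by rewrite finset.sub1set !inE eqxx.
  apply: (realizationI vK) => // -[[v'|?]|?]; rewrite /= ?eqxx // => pv.
  have : v' \in [set w | p w != 0]%SET by rewrite inE.
  by rewrite suppE !inE => /eqP ->.
- apply: (realizationI (tri1_in true b)) => // -[[v'|?]|?]; rewrite /= ?eqxx // => pv.
  have : v' \in [set w | p w != 0]%SET by rewrite inE.
  by rewrite suppE !inE => /orP[] /eqP ->; rewrite eqxx ?orbT.
Qed.

Lemma extend_inj : injective extend.
Proof.
move=> p q pq; apply/funext => v.
by have := congr1 (fun h : {ptws mapW D -> R} => h (vv D v)) pq.
Qed.

Lemma extend_continuous : continuous extend.
Proof.
have c0 (T : topologicalType) : continuous (fun _ : T => 0 : R).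
  by move=> x; exact: cvg_cst.
by apply: continuous_into_prod => -[[v|w]|w]; [exact: eval_continuous|exact: c0|exact: c0].
Qed.

Lemma emb_embedding : is_embedding e emb.
Proof.
split.
  apply: toM_comp_continuous; first exact: extend_in.
  by apply: continuous_subspaceT; exact: extend_continuous.
move=> p q /set_mem gp /set_mem gq /toM_inj pq; apply: extend_inj.
by apply: pq; exact: extend_in.
Qed.

Lemma edge_point_in (b : D) (t : R) : 0 <= t <= 1 ->
  graph_space R e (edge_point (tl b) (hd b) t).
Proof.
move=> /andP[t0 t1]; have /eqP th := @tl_neq_hd _ _ b.
split=> [w||].
- by rewrite /edge_point addr_ge0 // mulr_ge0 // subr_ge0.
- by rewrite /edge_point big_split /= -!mulr_sumr !sum_eq1; lra.
apply/graph_complexP; rewrite /edge_point.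
have [->|tn0] := eqVneq t 0.
  left; exists (tl b); apply/finset.setP => w; rewrite !inE.
  by rewrite subr0 mul1r mul0r addr0; case: (w == tl b); rewrite ?oner_eq0 ?eqxx.
have [->|tn1] := eqVneq t 1.
  left; exists (hd b); apply/finset.setP => w; rewrite !inE.
  by rewrite subrr mul1r mul0r add0r; case: (w == hd b); rewrite ?oner_eq0 ?eqxx.
right; exists b; apply/finset.setP => w; rewrite !inE.
have [->|wt] := eqVneq w (tl b).
  by rewrite (negPf th) mulr0 addr0 mulr1 subr_eq0 eq_sym tn1.
by case: (w == hd b); [rewrite mulr0 add0r mulr1 tn0|rewrite !mulr0 addr0 eqxx].
Qed.

(** At radius 1 the ring weights vanish. As this holds for both colours, the two closed faces are
    glued along the graph. *)
Lemma emb_edge c k (t : R) : (k < len D)%N -> 0 <= t <= 1 ->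
  emb (edge_point (tl (walk D c k)) (hd (walk D c k)) t)
  = toM (face_map c (1, k%:R + t)).
Proof.
move=> kL /andP[t0 t1]; congr toM; apply/funext => u.
rewrite face_map_up //; try lra.
have E v' v : (vv D v == vv D v') = (v == v') by apply/eqP/eqP => [[]|->].
have -> : 2 - 2 * 1 = 0 :> R by lra.
have -> : 2 * 1 - 1 - t = 1 - t :> R by lra.
case: u => [[v|w]|w].
- by rewrite -/(vv D v) !E mul0r add0r.
- by rewrite /= mul0r !mulr0 !addr0.
- by rewrite /= mul0r !mulr0 !addr0.
Qed.

Lemma face_weight_extend c p : face_weight c (extend p) = 0.
Proof. by rewrite /face_weight big1 // => -[[v|?]|?]. Qed.

Lemma emb_not_face c p : graph_space R e p -> ~ face_set c (emb p).
Proof.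
move=> gp; rewrite /face_set /= /emb toMK; last exact: extend_in.
by rewrite face_weight_extend ltxx.
Qed.

Lemma emb_complement : ~` (emb @` graph_space R e) = face_set true `|` face_set false.
Proof.
rewrite eqEsubset; split=> [z nz|z zf [p gp pz]]; last first.
  by move: zf; rewrite -pz => -[]; exact: emb_not_face.
have [c [x [rx zE]]] := polyhedron_cover z; have [x1|x1] := ltP x.1 1.
  have : face_set c z by rewrite zE; apply/face_set_face_map.
  by case: (c) => h; [left|right].
exfalso; apply: nz; have [k [t [[kL xE _ x1'] [t0 t1 _]]]] := rect_cases rx.
exists (edge_point (tl (walk D c k)) (hd (walk D c k)) t).
  by apply: edge_point_in; rewrite t0 t1.
have xE1 : x.1 = 1 by apply/le_anti; rewrite x1 x1'.
by rewrite emb_edge ?t0 ?t1 // zE xE xE1.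
Qed.

Lemma facesE F : faces e emb F <-> exists c, F = face_set c.
Proof.
have comp c z : face_set c z ->
    connected_component (face_set true `|` face_set false) z = face_set c.
  have cc := @face_set_connected R V D; have oo := @face_set_open R V D.
  have dd := @face_set_disjoint R V D.
  case: c => fz; first exact: component_of_two.
  by rewrite setUC; apply: component_of_two => //; rewrite setIC.
rewrite /faces; cbv zeta; rewrite emb_complement; split=> [[z zf <-]|[c ->]].
  by case: zf => /comp ->; [exists true|exists false].
have [z fz] := @face_set_neq0 R V D c.
by exists z; [case: c fz => fz; [left|right]|exact: comp].
Qed.

Definition boundary_circuit c : seq V := mkseq (fun k => tl (walk D c k)) (len D).

Lemma size_boundary c : size (boundary_circuit c) = len D.
Proof. exact: size_mkseq. Qed.

Lemma nth_boundary v0 c k : (k < len D)%N ->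
  nth v0 (boundary_circuit c) k = tl (walk D c k) /\
  nth v0 (boundary_circuit c) (k.+1 %% len D) = hd (walk D c k).
Proof.
move=> kL; rewrite nth_mkseq //; split=> //.
rewrite -(tl_step c) -walkS; have [kE|kn] := eqVneq k.+1 (len D).
  by rewrite kE modnn nth_mkseq ?walk_closed ?len_gt0.
by rewrite modn_small ?nth_mkseq //; lia.
Qed.

Lemma boundary_edges c : circuit_edges (boundary_circuit c)
  = mkseq (fun k => [set tl (walk D c k); hd (walk D c k)]%SET) (len D).
Proof.
have v0 := tl (walk D c 0).
rewrite (circuit_edges_nth v0) size_boundary; apply/eq_in_map => k.
by rewrite mem_iota add0n => /(nth_boundary v0 c)[-> ->].
Qed.

Lemma edge_set_inj (b b' : D) :
  [set tl b; hd b]%SET = [set tl b'; hd b']%SET -> b = b'.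
Proof.
move=> /finset.setP bb'; have := bb' (tl b); have := bb' (hd b).
rewrite !inE !eqxx orbT /= => /esym/orP[] /eqP h /esym/orP[] /eqP h'.
- by case: (@tl_neq_hd _ _ b); rewrite h h'.
- by case: (edge_antisym h' h).
- exact: edge_inj h' h.
- by case: (@tl_neq_hd _ _ b); rewrite h h'.
Qed.

Lemma boundary_uniq c : uniq (circuit_edges (boundary_circuit c)).
Proof.
rewrite boundary_edges; apply/mkseq_uniqP => i j; rewrite !inE => iL jL.
by move=> /edge_set_inj /walk_inj; exact.
Qed.

Lemma boundary_mem c : circuit_edges (boundary_circuit c) =i enum (graph_edges e).
Proof.
move=> A; rewrite boundary_edges mem_enum; apply/mapP/finset.imsetP.
  move=> [k _ ->]; exists (tl (walk D c k), hd (walk D c k)) => //.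
  by rewrite inE; apply/eP; exists (walk D c k); left.
move=> [[u v]]; rewrite inE => /eP[b]; have [k kL <-] := walk_surj c b.
case=> -[<- <-] -> /=; exists k; rewrite ?mem_iota //.
by rewrite finset.setUC.
Qed.

Lemma boundary_is_circuit c : is_circuit e (boundary_circuit c).
Proof.
have L2 := len_gt2 D; split; last exact: boundary_uniq.
  by rewrite -size_eq0 size_boundary; lia.
rewrite /boundary_circuit; have := walk_closed D c; case: (len D) L2 => // m _ wc.
rewrite /mkseq /= -{2}wc -[in rcons _ _](map_rcons (fun k => tl (walk D c k))).
have -> : rcons (iota 1 m) m.+1 = iota 1 m.+1.
  by rewrite -[X in _ = iota 1 X]addn1 iotaD cats1 add1n.
suff P n i : path e (tl (walk D c i)) [seq tl (walk D c k) | k <- iota i.+1 n] by exact: P.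
elim: n i => //= n IH i; rewrite IH andbT; apply/eP; exists (walk D c i); left.
by rewrite walkS tl_step.
Qed.

(** Each face boundary is an Eulerian circuit, so each decomposition consists of a single
    circuit. *)
Lemma boundary_decomposition c : circuit_decomposition e [:: boundary_circuit c].
Proof.
split=> [_ /[!inE]/eqP ->|]; first exact: boundary_is_circuit.
rewrite /= cats0; apply: uniq_perm; [exact: boundary_uniq|exact: enum_uniq|].
exact: boundary_mem.
Qed.

Lemma face_boundary_circuit c : face_boundary emb (face_set c) (boundary_circuit c).
Proof.
have [g [cg bg gE]] := @face_chart R V D c; exists g; split=> // k t t01 /=.
have v0 := tl (walk D c 0).
have kL : (k < len D)%N by rewrite -(size_boundary c).
rewrite !(tnth_nth v0) /=; move: (nat_of_ord k) kL => {}k kL.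
rewrite size_boundary; have [-> ->] := nth_boundary v0 c kL.
rewrite emb_edge // -gE.
  by rewrite /polar /= !mul1r.
apply/rectP; rewrite /= ler01 lexx; split=> //; case/andP: t01 => t0 t1.
have : k.+1%:R <= (len D)%:R :> R by rewrite ler_nat.
by rewrite -natr1; have := ler0n R k; lra.
Qed.

Lemma faces_cellular : cellular e emb.
Proof. by move=> F /facesE[c ->]; exact: face_set_disc. Qed.

Lemma face_set_inj : face_set true <> face_set false.
Proof.
move=> tf; have [z zt] := @face_set_neq0 R V D true.
have : (face_set true `&` face_set false) z by rewrite -tf.
by rewrite face_set_disjoint.
Qed.

Lemma emb_biembedding : is_biembedding e emb.
Proof.
exists [:: boundary_circuit true], [:: boundary_circuit false].
split; [exact: boundary_decomposition|exact: boundary_decomposition|].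
split; first exact: emb_embedding.
have single c (C : set (set M)) : C = [set face_set c] ->
    boundaries_are emb C [:: boundary_circuit c].
  move=> ->; exists (fun=> face_set c); split.
    split=> [i _ //|i j _ _ _|_ ->]; first by rewrite !ord1.
    by exists ord0.
  by move=> i; rewrite ord1; exact: face_boundary_circuit.
exists (fun F => `[< F = face_set true >]); split.
- move=> F G /facesE[c ->] /facesE[c' ->] cc' _.
  have tt : `[< face_set true = face_set true >] by apply/asboolP.
  have ft : `[< face_set false = face_set true >] = false.
    by apply/asboolP => /esym/face_set_inj.
  by case: c cc'; case: c' => cc'; rewrite ?tt ?ft.
- apply: single; rewrite eqEsubset; split=> [F [_ /asboolP]//|F ->].
  by split; [apply/facesE; exists true|apply/asboolP].
- apply: single; rewrite eqEsubset; split=> [F [/facesE[[] ->] /asboolP]//|F ->].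
  by split; [apply/facesE; exists false|apply/asboolP => /esym/face_set_inj].
Qed.

(** Points on the boundary circle are limits along radii of points of the open face. *)
Lemma face_set_limit c k (t : R) (Z : set M) : (k < len D)%N -> 0 <= t <= 1 ->
  closed Z -> face_set c `<=` Z -> Z (toM (face_map c (1, k%:R + t))).
Proof.
move=> kL /andP[t0 t1] clZ sZ; apply: contrapT => nZ.
have kL1 : k%:R + 1 <= (len D)%:R :> R by rewrite natr1 ler_nat.
have k0 : 0 <= k%:R :> R by [].
have rI r : 0 <= r <= 1 -> rect (len D) (r, k%:R + t).
  by move=> r01; apply/rectP; rewrite /= r01; split=> //; lra.
have cf : {within `[0, 1], continuous (fun r : R => toM (face_map c (r, k%:R + t)))}.
  apply: toM_comp_continuous => [r|].
    by rewrite /= in_itv /= => r01; exact/face_map_in/rI.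
  apply: continuous_subspaceT => r.
  apply: (@continuous_comp _ _ _ (fun r => (r, k%:R + t)) (face_map c)).
    exact: (@cvg_pair _ _ _ _ (nbhs r) (nbhs (k%:R + t)) _ _ _ id
      (fun=> k%:R + t) cvg_id (cvg_cst _)).
  exact: face_map_continuous.
move/subspace_continuousP : cf => /(_ 1); rewrite /= in_itv /= ler01 lexx => /(_ isT).
move=> /(_ (~` Z)) []; first by apply: open_nbhs_nbhs; split=> //; exact: closed_openC.
move=> d /= d0 dZ.
(* A radius less than 1 at distance less than [d] from 1; the cap 1/2 keeps it nonnegative. *)
have r01 : 0 <= 1 - Num.min (d / 2) 2^-1 < 1.
  by apply/andP; split; case: (leP (d / 2) 2^-1) => ?; lra.
have /andP[r0 r1] := r01.
apply: (dZ (1 - Num.min (d / 2) 2^-1)) => /=.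
- by rewrite opprB addrCA subrr addr0 ger0_norm; case: (leP (d / 2) 2^-1) => ?; lra.
- by rewrite in_itv /= r0 ltW.
- by apply: sZ; apply/face_set_face_map => //; apply: rI; rewrite r0 ltW.
Qed.

Lemma cycle_nth (v0 : V) (s : seq V) j : cycle e s -> (j < size s)%N ->
  e (nth v0 s j) (nth v0 s (j.+1 %% size s)).
Proof.
case: s => // v s /= /(pathP v0) es js.
have := es j; rewrite size_rcons => /(_ js); rewrite -rcons_cons nth_rcons /= js.
rewrite nth_rcons; have [jE|jn] := eqVneq j.+1 (size s).+1.
  by rewrite jE modnn; case: jE => ->; rewrite ltnn eqxx.
by rewrite modn_small; [|lia]; have -> : (j < size s)%N by lia.
Qed.

Lemma edge_pointC (u v : V) (t : R) : edge_point u v t = edge_point v u (1 - t).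
Proof. by apply/funext => w; rewrite /edge_point opprB addrCA subrr addr0 addrC. Qed.

Lemma edge_point_graph u v (t : R) : e u v -> 0 <= t <= 1 ->
  graph_space R e (edge_point u v t).
Proof.
move=> /eP[b [[<- <-]|[<- <-]]] /andP[t0 t1]; last rewrite edge_pointC.
  by apply: edge_point_in; rewrite t0.
by apply: edge_point_in; apply/andP; split; lra.
Qed.

(** Both ends have positive weight at the midpoint of an edge, so the midpoint determines the
    edge. *)
Lemma edge_point_half (b : D) u v (t : R) :
  edge_point (tl b) (hd b) 2^-1 = edge_point u v t ->
  [set tl b; hd b]%SET = [set u; v]%SET.
Proof.
move=> h; have /eqP th := @tl_neq_hd _ _ b.
have at_ w : edge_point (tl b) (hd b) 2^-1 w != 0 :> R -> w = u \/ w = v.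
  rewrite h /edge_point; case: (eqVneq w u) => [|wu]; first by left.
  by case: (eqVneq w v) => [|wv]; [right|rewrite !mulr0 addr0 eqxx].
have h2 : 2^-1 != 0 :> R by rewrite invr_eq0 pnatr_eq0.
have tuv : tl b = u \/ tl b = v.
  apply: at_; rewrite /edge_point eqxx (negPf th) mulr0 addr0 mulr1.
  by apply/eqP; lra.
have huv : hd b = u \/ hd b = v.
  by apply: at_; rewrite /edge_point eqxx [hd b == _]eq_sym (negPf th) mulr0 add0r mulr1.
move: th; case: tuv => ->; case: huv => ->; rewrite ?eqxx // => _.
exact: finset.setUC.
Qed.

(* The closure of a face contains the whole graph, so a boundary circuit of a
   face runs through every edge. *)
Lemma face_length_eq F l : faces e emb F -> face_length e emb F l -> l = len D.
Proof.
move=> /facesE[c ->] [s [[s0 es us] [g [cg [gf gi gs] gE]] <-]].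
have v0 := tl (walk D c 0).
have sz0 : (0 < size s)%N by rewrite lt0n size_eq0.
have cm : closed (g @` @closed_disc R).
  apply: compact_closed; first exact: polyhedron_hausdorff.
  apply: continuous_compact => //.
  rewrite -(polar_image R (len_gt0 D)); apply: continuous_compact.
    by apply: continuous_subspaceT; exact: polar_continuous.
  exact: rect_compact.
have sub : face_set c `<=` g @` @closed_disc R.
  by move=> z /gs[y oy <-]; exists y => //; exact: ltW.
have sE := circuit_edges_nth v0 s.
(* The midpoint of each edge is a value of [g] on the closed disc. It is not in the open face, so it
   comes from the unit circle and lies on an edge of [s], which must be the given one. *)
have cover k : (k < len D)%N ->
    [set tl (walk D c k); hd (walk D c k)]%SET \in circuit_edges s.
  move=> kL; set b := walk D c k.
  have halfI : 0 <= (2^-1 : R) <= 1 by apply/andP; split; lra.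
  have [z cz gz] := face_set_limit kL halfI cm sub.
  move: gz; rewrite -emb_edge // -/b => gz.
  have nz : ~ open_disc z.
    by move=> /gf; rewrite gz; apply: emb_not_face; exact: edge_point_in.
  move: cz; rewrite -(polar_image R sz0) => -[[r a] /rectP[/= /andP[r0 r1] ra] zE].
  have rE : r = 1.
    apply/le_anti; rewrite r1 leNgt; apply/negP => rlt; apply: nz.
    by rewrite /open_disc /mkset -zE polar_norm expr_lt1.
  have [j [t [js t01 aE]]] := nat_frac sz0 ra.
  have := gE (Ordinal js) t t01; rewrite /= !(tnth_nth v0) /=.
  have -> : (cos (2 * pi * (j%:R + t) / (size s)%:R),
      sin (2 * pi * (j%:R + t) / (size s)%:R)) = z.
    by rewrite -zE rE aE /polar /= !mul1r.
  rewrite gz => bst; have euv := cycle_nth v0 es js.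
  rewrite sE; apply/mapP; exists j; first by rewrite mem_iota.
  apply: (@edge_point_half _ _ _ t).
  by apply: emb_embedding.2 bst; apply/mem_set; [exact: edge_point_in|exact: edge_point_graph].
(* Neither circuit repeats an edge, so having the same edges forces equal lengths. *)
have -> : size s = size (circuit_edges s) by rewrite sE size_mkseq.
have -> : len D = size (circuit_edges (boundary_circuit c)).
  by rewrite boundary_edges size_mkseq.
apply: perm_size; apply: uniq_perm => //; first exact: boundary_uniq.
move=> A; apply/idP/idP; last first.
  by rewrite boundary_edges => /mapP[k]; rewrite mem_iota add0n => /cover h ->.
rewrite sE boundary_mem mem_enum => /mapP[j]; rewrite mem_iota add0n => js ->.
apply/finset.imsetP; exists (nth v0 s j, nth v0 s (j.+1 %% size s)) => //.
by rewrite inE; exact: cycle_nth.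
Qed.

End Graph.

(** * Maps from half sets in abelian groups *)

Section HalfSetMap.
Variables (G : finZmodType) (N : nat) (s : 'I_N.+1 -> G).
Hypotheses (N_even : ~~ odd N) (GN : (2 < #|G| * N.+1)%N).
Hypothesis s_inj : injective s.
Hypothesis s_half : forall i j, s i + s j <> 0.
Let total := \sum_i s i.
Hypothesis total_gen : forall j, total *+ j = 0 -> (#|G| %| j)%N.
Implicit Types (c : bool) (g : G) (i : 'I_N.+1) (k : nat).

Let unit1 : 'I_N.+1 := inZp 1.
Definition shift c : 'I_N.+1 := if c then unit1 else unit1 *+ 2.

Definition hs_step c (b : G * 'I_N.+1) := (b.1 + s b.2, b.2 + shift c).
Definition hs_pstep c (b : G * 'I_N.+1) :=
  (b.1 - s (b.2 - shift c), b.2 - shift c).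
Definition hs_walk c k := iter k (hs_step c) (0, 0).
Definition hs_inn g k := (g - s (unit1 *+ k), unit1 *+ k).

Lemma unit1_mul k : unit1 *+ k = inZp k.
Proof. by rewrite Zp_mulrn; apply: val_inj; rewrite /= modnMml mul1n. Qed.

Lemma unit1_mul0 k : unit1 *+ k = 0 -> (N.+1 %| k)%N.
Proof. by rewrite unit1_mul => /(congr1 val) /= h; rewrite /dvdn h. Qed.

Lemma unit1_mulN : unit1 *+ N.+1 = 0.
Proof. by rewrite unit1_mul; apply: val_inj; rewrite /= modnn. Qed.

(** For the shift 2 this is the invertibility of 2 modulo the odd number [N.+1]. *)
Lemma shift_mul0 c k : shift c *+ k = 0 -> (N.+1 %| k)%N.
Proof.
case: c => /=; first exact: unit1_mul0.
rewrite -mulrnA => /unit1_mul0; rewrite Gauss_dvdr //.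
by rewrite coprime_sym coprime2n /= N_even.
Qed.

Lemma shift_mulN c : shift c *+ N.+1 = 0.
Proof.
by case: c; rewrite /= ?unit1_mulN // mulrnAC unit1_mulN mul0rn.
Qed.

Lemma mulrn_inj (A : zmodType) (a : A) (m : nat) :
  (forall k, a *+ k = 0 -> (m %| k)%N) ->
  forall k l, (k < m)%N -> (l < m)%N -> a *+ k = a *+ l -> k = l.
Proof.
move=> am k l; wlog kl : k l / (k <= l)%N.
  move=> H km lm akl; case/orP: (leq_total k l) => kl; first exact: H.
  by apply/esym/H.
move=> km lm /esym/eqP; rewrite -subr_eq0 -mulrnBr // => /eqP/am.
by move=> /dvdn_leq; lia.
Qed.

Lemma shift_bij c : bijective (fun j : 'I_N.+1 => shift c *+ j).
Proof.
apply: injF_bij => i j h; apply: val_inj.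
by apply: (mulrn_inj (@shift_mul0 c)) h; exact: ltn_ord.
Qed.

Lemma hs_stepK c : cancel (hs_step c) (hs_pstep c).
Proof. by move=> [g i]; rewrite /hs_pstep /hs_step /= addrK addrK. Qed.

Lemma hs_pstepK c : cancel (hs_pstep c) (hs_step c).
Proof. by move=> [g i]; rewrite /hs_pstep /hs_step /= subrK subrK. Qed.

Lemma iter_hs_step c k g i : iter k (hs_step c) (g, i)
  = (g + \sum_(j < k) s (i + shift c *+ j), i + shift c *+ k).
Proof.
elim: k => [|k IH]; first by rewrite big_ord0 mulr0n !addr0.
by rewrite iterS IH /hs_step /= big_ord_recr /= addrA mulrSr addrA.
Qed.

Lemma sum_shift c i : \sum_(j < N.+1) s (i + shift c *+ j) = total.
Proof.
rewrite /total [RHS](reindex_inj (h := fun j : 'I_N.+1 => i + shift c *+ j)) //.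
by move=> j l /addrI h; apply: (bij_inj (shift_bij c)).
Qed.

Lemma iter_hs_turns c q g i : iter (q * N.+1) (hs_step c) (g, i) = (g + total *+ q, i).
Proof.
elim: q => [|q IH]; first by rewrite mulr0n addr0.
by rewrite mulSn iterD IH iter_hs_step sum_shift shift_mulN addr0 mulrSr addrA.
Qed.

(** A full turn of [N.+1] steps keeps the index and adds [total]. The edge (g, i) is reached by the
    j steps that bring the index to i, preceded by q turns making up the difference in G, which
    exist because [total] generates G. *)
Lemma hs_walk_surj c b : exists2 k, (k < #|G| * N.+1)%N & hs_walk c k = b.
Proof.
case: b => g i; have [h h1 h2] := shift_bij c; set j := h i.
have inj : injective (fun q : 'I_#|G| => total *+ q).
  by move=> q q' e; apply: val_inj; apply: (mulrn_inj total_gen) e; exact: ltn_ord.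
have [q qE] : exists q : 'I_#|G|, total *+ q = g - \sum_(l < j) s (0 + shift c *+ l).
  have := inj_card_onto inj; rewrite card_ord leqnn => /(_ isT).
  by move=> /(_ (g - \sum_(l < j) s (0 + shift c *+ l)))/codomP[q qE]; exists q.
exists (j + q * N.+1)%N.
  have := ltn_ord j; have := ltn_ord q; nia.
by rewrite /hs_walk iterD iter_hs_turns iter_hs_step add0r qE subrK add0r h2.
Qed.

(** A surjection between finite sets of the same cardinality is injective. *)
Lemma hs_walk_inj c k l : (k < #|G| * N.+1)%N -> (l < #|G| * N.+1)%N ->
  hs_walk c k = hs_walk c l -> k = l.
Proof.
move=> il jl ij.
suff : injective (fun m : 'I_(#|G| * N.+1) => hs_walk c m).
  by move=> /(_ (Ordinal il) (Ordinal jl) ij) [].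
apply/injectiveP; apply/card_uniqP; rewrite size_map -cardE card_ord.
have -> : #|codom (fun k : 'I_(#|G| * N.+1) => hs_walk c k)| = #|{: G * 'I_N.+1}|.
  apply: eq_card => b; rewrite inE; have [m ml <-] := hs_walk_surj c b.
  by apply/codomP; exists (Ordinal ml).
by rewrite card_prod card_ord.
Qed.

Lemma hs_walk_closed c : hs_walk c (#|G| * N.+1) = hs_walk c 0.
Proof.
have [[|k] kl kE] := hs_walk_surj c (hs_walk c (#|G| * N.+1)); first by rewrite kE.
(* If the walk closed up at a positive time, undoing one step would contradict injectivity. *)
have LE : (#|G| * N.+1 = (#|G| * N.+1).-1.+1)%N by lia.
move: kE; rewrite LE /hs_walk !iterS => /(can_inj (hs_stepK c)).
by move=> /hs_walk_inj; lia.
Qed.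

Definition half_set_map : edge_map G.
Proof.
apply: (@EdgeMap G (G * 'I_N.+1)%type fst (fun b => b.1 + s b.2) _ _ hs_step
  hs_pstep hs_stepK hs_pstepK _ (#|G| * N.+1) GN hs_walk hs_walk_closed
  hs_walk_inj hs_walk_surj _ N.+1 hs_inn).
- by move=> [g i] [g' i'] /= -> /addrI/s_inj ->.
- move=> [g i] [g' i'] /= -> h; apply: (@s_half i' i).
  by apply: (@addrI _ g'); rewrite addrA addr0.
- by [].
- by [].
- by [].
- by move=> v; rewrite /hs_inn unit1_mulN mulr0n.
- move=> v i j iN jN /(congr1 snd) /=.
  exact: (mulrn_inj unit1_mul0).
- move=> [g i]; exists i; first exact: ltn_ord.
  by rewrite /hs_inn unit1_mul valZpK /= addrK.
- by move=> v k; rewrite /hs_inn /= subrK.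
(* Both sides are the outgoing edge (v, k + 2): shift 1 from index k + 1, shift 2 from index k. *)
- by move=> v k; rewrite /hs_step /hs_inn /= !subrK mulrSr mulr2n addrA.
Defined.

Lemma half_set_mapP (u v : G) :
  (exists i, v = u + s i \/ u = v + s i) <->
  exists b : half_set_map, (tl b = u /\ hd b = v) \/ (tl b = v /\ hd b = u).
Proof.
split=> [[i [->|->]]|[[g i] [[<- <-]|[<- <-]]]].
- by exists (u, i); left.
- by exists (v, i); right.
- by exists i; left.
- by exists i; right.
Qed.

End HalfSetMap.

(** * The half set *)

HB.instance Definition _ (A B : finZmodType) := Finite.on (A * B)%type.

Lemma sum_divn_modn (A : nmodType) (m n : nat) (F : nat -> nat -> A) :
  \sum_(i < m * n) F (i %/ n)%N (i %% n)%N = \sum_(j < m) \sum_(k < n) F j k.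
Proof.
rewrite -(big_mkord xpredT (fun i => F (i %/ n)%N (i %% n)%N)).
elim: m => [|m IH]; first by rewrite mul0n big_nil big_ord0.
rewrite mulSnr (big_cat_nat (n := m * n)) ?leq_addr //= IH big_ord_recr /=.
congr (_ + _); rewrite -{1}[(m * n)%N]add0n big_addn addKn big_mkord.
apply: eq_bigr => k _; have n0 : (0 < n)%N by exact: leq_ltn_trans (ltn_ord k).
by rewrite addnC divnMDl // divn_small // addn0 modnMDl modn_small.
Qed.

Lemma inZpD (m a b : nat) : inZp (a + b) = inZp a + inZp b :> 'I_m.+1.
Proof. by apply: val_inj; rewrite /= modnDm. Qed.

Lemma inZp_sum (m : nat) (I : Type) (r : seq I) (F : I -> nat) :
  \sum_(i <- r) inZp (F i) = inZp (\sum_(i <- r) F i)%N :> 'I_m.+1.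
Proof.
elim: r => [|i r IH]; last by rewrite !big_cons inZpD IH.
by rewrite !big_nil; apply: val_inj; rewrite /= mod0n.
Qed.

Lemma inZp_mulrn (m a k : nat) : inZp a *+ k = inZp (a * k) :> 'I_m.+1.
Proof. by rewrite Zp_mulrn; apply: val_inj; rewrite /= modnMml. Qed.

Lemma inZp_eq0 (m a : nat) : inZp a = 0 :> 'I_m.+1 -> (m.+1 %| a)%N.
Proof. by move=> /(congr1 val) /= h; rewrite /dvdn h. Qed.

Section ConcreteHalfSet.
Variables (n' q' : nat).
Local Notation n := n'.+1.
Local Notation q := q'.+1.
Hypothesis qE : q = (2 * n + 1)%N.
Let G : finZmodType := ('I_q * 'I_n)%type.
Let N := (n * n).-1.
Implicit Types (i j : 'I_N.+1) (k : nat).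

Lemma N_eq : N.+1 = (n * n)%N.
Proof. by rewrite /N prednK. Qed.

Definition base k : G := (inZp (k %/ n).+1, inZp (k %% n)).

(* The index of [(n, 1)], whose change of sign makes the second component of the
   sum a generator of [Z_n]. *)
Definition flipped : nat := (n' * n + 1 %% n)%N.
Definition half i : G := if i == flipped :> nat then - base i else base i.

Lemma index_bound i : ((i %/ n)%N < n)%N.
Proof. by rewrite ltn_divLR // -N_eq. Qed.

Lemma base1 i : (base i).1 = (i %/ n).+1 :> nat.
Proof. by rewrite /= modn_small //; have := index_bound i; lia. Qed.

Lemma base_inj i j : base i = base j -> i = j.
Proof.
move=> ij; have := congr1 (fun g : G => nat_of_ord g.1) ij.
rewrite !base1 => -[h1]; have := congr1 (fun g : G => nat_of_ord g.2) ij.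
rewrite /= !modn_mod => h2; apply: val_inj.
by rewrite /= (divn_eq i n) h1 h2 -divn_eq.
Qed.

(** First components lie between 1 and n, so two of them add up to at most 2n < q. *)
Lemma base_half i j : base i + base j <> 0.
Proof.
move=> /(congr1 (fun g : G => nat_of_ord g.1)).
have -> : nat_of_ord (base i + base j).1 = (((base i).1 + (base j).1) %% q)%N by [].
rewrite !base1; have bi := index_bound i; have bj := index_bound j.
by rewrite modn_small //; lia.
Qed.

(** One of d and -d has its first component between 1 and n; division by n then yields the index. *)
Lemma base_surj (d : G) : d.1 != 0 -> exists i, d = base i \/ d = - base i.
Proof.
have small (g : G) : (0 < g.1)%N -> (g.1 <= n)%N -> exists i, g = base i.
  case: g => a b /= a0 an.
  have iN : ((a.-1 * n + b) < N.+1)%N by rewrite N_eq; have := ltn_ord b; nia.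
  exists (Ordinal iN); rewrite /base /= divnMDl // divn_small // addn0.
  rewrite modnMDl; congr (_, _); apply: val_inj => /=.
    by rewrite prednK // modn_small.
  by rewrite modn_mod modn_small.
move=> d0; have d1 : (0 < d.1)%N by rewrite lt0n; move: d0; rewrite -val_eqE.
have [dn|dn] := leqP d.1 n; first by have [i ->] := small _ d1 dn; exists i; left.
have dq := ltn_ord d.1.
have dN : nat_of_ord (- d).1 = (q - d.1)%N.
  by rewrite -[LHS]/((q - d.1) %% q)%N modn_small //; lia.
have [||i iE] := small (- d); rewrite ?dN.
- by lia.
- by lia.
- by exists i; right; rewrite -iE opprK.
Qed.

Lemma half_inj : injective half.
Proof.
move=> i j; rewrite /half; case: ifP => fi; case: ifP => fj.
- by move=> /oppr_inj/base_inj.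
- by move=> /esym/eqP; rewrite -addr_eq0 => /eqP/base_half.
- by move=> /eqP; rewrite -addr_eq0 => /eqP/base_half.
- by move=> /base_inj.
Qed.

Lemma half_half i j : half i + half j <> 0.
Proof.
rewrite /half; case: ifP => fi; case: ifP => fj.
- by rewrite -opprD => /eqP; rewrite oppr_eq0 => /eqP/base_half.
- rewrite addrC => /eqP; rewrite subr_eq0 => /eqP/base_inj ij.
  by rewrite ij fi in fj.
- by move=> /eqP; rewrite subr_eq0 => /eqP/base_inj ij; rewrite ij fj in fi.
- exact: base_half.
Qed.

Lemma half_edge (u v : G) :
  u.1 != v.1 <-> exists i, v = u + half i \/ u = v + half i.
Proof.
split=> [uv|].
  have [|i] := @base_surj (v - u); first by rewrite /= subr_eq0 eq_sym.
  case=> iE; exists i; rewrite /half; case: ifP => _.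
  - by right; rewrite -iE opprB addrC subrK.
  - by left; rewrite -iE addrC subrK.
  - by left; rewrite -iE addrC subrK.
  - by right; rewrite -[base i]opprK -iE opprB addrC subrK.
have half1 i : (half i).1 != 0.
  have b1 : (base i).1 != 0.
    by apply/eqP => /(congr1 (@nat_of_ord _)); rewrite base1.
  by rewrite /half; case: ifP => _ //; rewrite /= oppr_eq0.
case=> i [->|->]; first by rewrite eq_sym /= addrC -subr_eq0 addrK.
by rewrite /= addrC -subr_eq0 addrK.
Qed.

Lemma flipped_lt : (flipped < N.+1)%N.
Proof.
have := ltn_pmod 1 (ltn0Sn n'); rewrite N_eq /flipped.
have -> : (n * n = n' * n + n)%N by exact: mulSnr.
by rewrite ltn_add2l.
Qed.

Lemma half_total : \sum_i half i = \sum_(i < N.+1) base i - base flipped *+ 2.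
Proof.
pose i0 := Ordinal flipped_lt.
rewrite (bigD1 i0) //= [X in _ = X - _](bigD1 i0) //=.
have -> : \sum_(i < N.+1 | i != i0) half i = \sum_(i < N.+1 | i != i0) base i.
  by apply: eq_bigr => i; rewrite -val_eqE /half => /negPf ->.
by rewrite /half eqxx mulr2n opprD [RHS]addrA [X in _ = X - _ - _]addrC addrK addrC.
Qed.

Lemma sum_triangular m : (2 * \sum_(j < m) j.+1 = m * m.+1)%N.
Proof.
elim: m => [|m IH]; first by rewrite big_ord0.
by rewrite big_ord_recr /= mulnDr IH -mulnDl addn2 mulnC.
Qed.

Let T := (\sum_(j < n) j.+1)%N.

(** Each first component occurs n times, whence n T. The sum over Z_n is also repeated n times,
    hence zero. *)
Lemma sum_base : \sum_(i < N.+1) base i = (inZp (n * T), 0) :> G.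
Proof.
have pairE (I : finType) (F : I -> G) : \sum_i F i = (\sum_i (F i).1, \sum_i (F i).2).
  elim/big_rec3: _ => // i x1 x2 x _ ->; by case: (F i).
have -> : \sum_(i < N.+1) base i = \sum_(i < n * n) base i by rewrite -N_eq.
rewrite pairE /base /=; congr (_, _).
  rewrite inZp_sum (sum_divn_modn n n (fun a _ => a.+1)) /T big_distrr.
  congr (inZp _); apply: eq_bigr => j _.
  by have := sum_nat_const 'I_n j.+1; rewrite card_ord.
rewrite (sum_divn_modn n n (fun _ b => inZp b)) sumr_const card_ord inZp_sum.
by rewrite inZp_mulrn; apply: val_inj; rewrite /= modnMl.
Qed.

Hypotheses (n_odd : odd n) (q_prime : prime q).

Lemma half_total_gen k : (\sum_i half i) *+ k = 0 -> (#|G| %| k)%N.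
Proof.
rewrite half_total sum_base => tk.
have fq : (flipped %/ n = n')%N.
  by rewrite /flipped divnMDl // divn_small ?addn0 // ltn_pmod.
have fr : (flipped %% n = 1 %% n)%N by rewrite /flipped modnMDl modn_mod.
have tk1 : ((inZp (n * T) - inZp n *+ 2) *+ k = 0 :> 'I_q).
  by move: (congr1 fst tk); rewrite (raddfMn fst) /base fq fr.
have tk2 : (inZp 1 *+ (2 * k) = 0 :> 'I_n).
  move: (congr1 snd tk); rewrite (raddfMn snd) /base fq fr /= add0r mulNrn.
  move=> /eqP; rewrite oppr_eq0 => /eqP; rewrite mulrnA.
  (* For n = 1 the remainder [1 %% n] is 0, which is the same element of Z_1. *)
  have -> : inZp 1 = inZp (1 %% n) :> 'I_n by apply: val_inj; rewrite /= modn_mod.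
  exact.
have nk : (n %| k)%N.
  move: tk2; rewrite inZp_mulrn mul1n => /inZp_eq0; rewrite Gauss_dvdr //.
  by rewrite coprime_sym coprime2n n_odd.
have qk : (q %| k)%N.
  have nE : - inZp n = inZp n.+1 :> 'I_q.
    apply/eqP; rewrite eq_sym -addr_eq0 -inZpD; apply/eqP/val_inj => /=.
    by rewrite (_ : n.+1 + n = q)%N ?modnn // qE; lia.
  move: tk1; rewrite -mulNrn nE inZp_mulrn -inZpD inZp_mulrn => /inZp_eq0.
  rewrite Euclid_dvdM // => /orP[qA|//]; exfalso.
  have TE := sum_triangular n; rewrite -/T in TE.
  (* Division by 2n + 1 with remainder 17: modulo q, n T = 1/16 and 2 (n + 1) = 1. The factor 16
     clears the denominator. *)
  have AE : (16 * (n * T + n.+1 * 2) = q * (4 * n * n + 2 * n + 15) + 17)%N.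
    rewrite qE; nia.
  have : (q %| 17)%N by have := dvdn_mull 16 qA; rewrite AE dvdn_addr // dvdn_mulr.
  have /= := (@primeP 17 isT).2 q; move=> h /h /orP[] /eqP qv.
    by move: q_prime; rewrite qv.
  have n8 : n = 8 by lia.
  by move: n_odd; rewrite n8.
(* As q = 2n + 1 is prime to n, divisibility by both factors gives divisibility by the order of
   G. *)
rewrite card_prod !card_ord Gauss_dvd ?qk ?nk //.
by rewrite qE /coprime gcdnC gcdnMDl gcdn1.
Qed.

End ConcreteHalfSet.

Lemma multipartite_biembedding (R : realType) (n' q' : nat) :
  odd n'.+1 -> prime q'.+1 -> q'.+1 = (2 * n'.+1 + 1)%N ->
  let e := @complete_multipartite q'.+1 n'.+1 in
  exists (M : topologicalType)
         (phi : {ptws ('I_q'.+1 * 'I_n'.+1)%type -> R} -> M),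
    [/\ is_surface R M, orientable R M, is_biembedding e phi, cellular e phi
      & forall (F : set M) (l : nat),
          faces e phi F -> face_length e phi F l -> (n'.+1 * q'.+1 %| l)%N].
Proof.
move=> n_odd q_prime qE e.
have N_even : ~~ odd (n'.+1 * n'.+1).-1.
  by have := oddM n'.+1 n'.+1; rewrite n_odd -{1}(N_eq n') /=; case: odd.
have GN : (2 < #|{: 'I_q'.+1 * 'I_n'.+1}| * (n'.+1 * n'.+1).-1.+1)%N.
  by rewrite card_prod !card_ord N_eq; nia.
pose D := half_set_map N_even GN (half_inj qE) (half_half qE)
  (half_total_gen qE n_odd q_prime).
have eP u v : e u v <-> exists b : D, (tl b = u /\ hd b = v) \/ (tl b = v /\ hd b = u).
  by rewrite -half_set_mapP -half_edge.
pose w0 := ff D true.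
exists (set_type (realization R (cplx (map_links D)))), (@emb R _ D); split.
- by apply: (polyhedron_surface w0); exact: polyhedron_connected.
- exact: (@polyhedron_orientable R _ _ w0).
- exact: emb_biembedding.
- exact: faces_cellular.
- move=> F l fF /(face_length_eq eP fF) ->; rewrite /= card_prod !card_ord.
  by rewrite mulnC dvdn_mulr // mulnC.
Qed.

Theorem proposition5p11 (R : realType) (n : nat)
    (n_ge1 : (1 <= n)%N) (n_odd : odd n) (n_prime : prime (2 * n + 1)) :
  let e := @complete_multipartite (2 * n + 1) n in
  exists (M : topologicalType)
         (phi : {ptws ('I_(2 * n + 1) * 'I_n)%type -> R} -> M),
    [/\ is_surface R M, orientable R M, is_biembedding e phi, cellular e phi
      & forall (F : set M) (l : nat),
          faces e phi F -> face_length e phi F l -> (n * (2 * n + 1) %| l)%N].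
Proof.
case: n n_ge1 n_odd n_prime => // n' _ n_odd.
have qE : (2 * n'.+1 + 1)%N = (2 * n'.+1 + 1)%N by [].
(* The number of parts is made a visible successor, the form in which the ordinals carry their
   cyclic group structure. *)
move: {-1}(2 * n'.+1 + 1)%N qE => [|q'] qE q_prime; first by rewrite addn1 in qE.
exact: multipartite_biembedding.
Qed.
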